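(* Let $M$ be a formal Levi-nondegenerate hypersurface in $\mathbb{C}^{n+1}$ of signature $\ell\le n/2$ at a point $p$, and let $N\ge n$ and $\ell'\le N/2$. (1) $M$ admits a formal CR transversal embedding into $\mathbb{H}^{2N+1}_{\ell'}$ if and only if $\ell'\ge\ell$ and there are formal coordinates $(z,w)\in\mathbb{C}^n\times\mathbb{C}$, vanishing at $p$, such that $M$ is defined by an equation of the form $$\operatorname{Im}w=\langle z,\bar z\rangle_\ell+A(z,\bar z,w,\bar w)\qquad( * )$$ with $A\in\mathcal{H}_{N-n}$. More precisely: (2) If $A\in\mathcal{H}_k$ for some $k$, then the hypersurface $M$ given by $( * )$ admits a formal CR transversal embedding into $\mathbb{H}^{2N+1}_{\ell'}$ with $N=n+k$ and $\ell'=\min(\ell+\mathrm{S}(A),\,N-\ell-\mathrm{S}(A))$. (3) Conversely, if $M$ admits a formal CR transversal embedding into $\mathbb{H}^{2N+1}_{\ell'}$, then there are formal coordinates $(z,w)\in\mathbb{C}^n\times\mathbb{C}$ vanishing at $p$ and a formal power series $A(z,\bar z,w,\bar w)$ such that $M$ is defined by $( * )$ with $\mathrm{R}(A)\le N-n$ and $\mathrm{S}(A)\le\max(\ell'-\ell,\,N-\ell'-\ell)$. Moreover, if in addition $\ell'<n-\ell$, then $\mathrm{S}(A)\le\ell'-\ell$ holds.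
   Context: Notation: for $0\le\ell\le m$, $\langle a,b\rangle_\ell:=-\sum_{j=1}^{\ell}a_jb_j+\sum_{j=\ell+1}^m a_jb_j$ for $a,b\in\mathbb{C}^m$, and $\mathbb{H}^{2m+1}_\ell:=\{(z,w)\in\mathbb{C}^m\times\mathbb{C}:\operatorname{Im}w=\langle z,\bar z\rangle_\ell\}$. In equation $( * )$, $A$ is a real-valued formal power series vanishing at least to fourth order at $0$. Rank, signature, and $\mathcal{H}_k$: a formal power series $A(Z,\bar Z)$, $Z=(z,w)\in\mathbb{C}^n\times\mathbb{C}$, is real-valued if $A(Z,\bar Z)=\overline{A(Z,\bar Z)}$ formally. Put $V_A:=\operatorname{span}_{\mathbb{C}}\{\frac{\partial^\alpha A}{\partial\bar Z^\alpha}(Z,0):\alpha\in\mathbb{N}^{n+1}\}\subset\mathbb{C}[[Z]]$, where $\mathbb{N}$ denotes the nonnegative integers; the rank $\mathrm{R}(A)$ is $\dim_{\mathbb{C}}V_A$. If $\mathrm{R}(A)=r<\infty$, there are an integer $0\le s\le r$ and linearly independent $\phi_1,\dots,\phi_r\in\mathbb{C}[[Z]]$ with $A(Z,\bar Z)=-\sum_{j=1}^s|\phi_j(Z)|^2+\sum_{j=s+1}^r|\phi_j(Z)|^2$; the (uniquely determined) number $\mathrm{S}(A):=s$ is the signature of $A$. For an integer $k\ge0$, $\mathcal{H}_k$ is the set of real-valued $A(z,\bar z,w,\bar w)$ such that $\mathrm{R}(A)\le k$ and no element of $V_A$ has a constant or linear term; equivalently, $A=\sum_{j=1}^k\phi_j\overline{\psi_j}$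 with $\phi_j,\psi_j\in\mathbb{C}[[z,w]]$ having no constant or linear terms. Formal objects: a formal hypersurface $M\subset\mathbb{C}^{n+1}$ at $p$ is given by $\rho(Z,\bar Z)=0$, where $\rho$ is a real-valued formal power series in $(Z-p,\overline{Z-p})$ without constant term and with nonzero differential at $p$. It is Levi-nondegenerate of signature $\ell$ ($\ell\le n/2$) at $p$ if in some formal holomorphic coordinates $(z,w)$ vanishing at $p$ it is given by $\operatorname{Im}w=\langle z,\bar z\rangle_\ell+B(z,\bar z,\operatorname{Re}w)$ with $B$ vanishing to third order at $0$. A formal embedding of $(M,p)$ into $(M',0)$, $M'=\{\rho'=0\}\subset\mathbb{C}^{N+1}$, is a vector $H=(H_1,\dots,H_{N+1})$ of formal power series in $Z-p$ without constant terms, with injective differential at $p$, such that $\rho'(H,\overline H)$ is a multiple of $\rho$ in the ring of formal power series. It is CR transversal if $dH(T_pM)\not\subset T^c_0M':=T_0M'\cap iT_0M'$; for $M'=\mathbb{H}^{2N+1}_{\ell'}$, in coordinates $(z,w)$ as in $( * )$, this is equivalent to $\frac{\partial H_{N+1}}{\partial w}(0)\ne0$.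
   Formalization: In (1) the ''if'' half is proved for some ℓ'' with ℓ≤ℓ''≤N/2 (the value given by (2)) rather than for every given ℓ'≥ℓ, which is false: for n=N=2, ℓ=0, ℓ'=1, A=0 the sphere would embed in a hyperquadric of different Levi signature. *)

(* Defs.v *)
From HB Require Import structures.
From mathcomp Require Import all_boot all_order all_algebra.
From mathcomp Require Import boolp classical_sets reals.
From mathcomp Require Import complex mpoly.

Set Implicit Arguments.
Unset Strict Implicit.
Unset Printing Implicit Defensive.

Import GRing.Theory Num.Theory.
Local Open Scope ring_scope.

(** * Formal power series *)

(* [f m] is the coefficient of the monomial of exponent [m]. *)
Record fps (A : Type) (d : nat) := Fps { fcoef :> 'X_{1..d} -> A }.

HB.instance Definition _ (A : Type) (d : nat) := gen_eqMixin (fps A d).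
HB.instance Definition _ (A : Type) (d : nat) := gen_choiceMixin (fps A d).

Lemma fpsP (A : Type) (d : nat) (f g : fps A d) :
  (forall m, f m = g m) -> f = g.
Proof. by case: f g => [f] [g] /= /funext ->. Qed.

Section Ring.
Variables (A : comNzRingType) (d : nat).
Implicit Types f g h : fps A d.

Definition fps_zero : fps A d := Fps (fun=> 0).
Definition fps_opp f : fps A d := Fps (fun m => - f m).
Definition fps_add f g : fps A d := Fps (fun m => f m + g m).
Definition fps_one : fps A d := Fps (fun m => (m == 0%MM)%:R).
Definition fps_mul f g : fps A d := Fps (fun m =>
  \sum_(k : 'X_{1..d < (mdeg m).+1, (mdeg m).+1} | m == (k.1 + k.2)%MM)
    f k.1 * g k.2).
Definition fps_scale (a : A) f : fps A d := Fps (fun m => a * f m).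

Fact fps_addA : associative fps_add.
Proof. by move=> f g h; apply: fpsP => m /=; rewrite addrA. Qed.
Fact fps_addC : commutative fps_add.
Proof. by move=> f g; apply: fpsP => m /=; rewrite addrC. Qed.
Fact fps_add0 : left_id fps_zero fps_add.
Proof. by move=> f; apply: fpsP => m /=; rewrite add0r. Qed.
Fact fps_addN : left_inverse fps_zero fps_opp fps_add.
Proof. by move=> f; apply: fpsP => m /=; rewrite addNr. Qed.

HB.instance Definition _ :=
  GRing.isZmodule.Build (fps A d) fps_addA fps_addC fps_add0 fps_addN.

(* Truncation to a polynomial, used to transfer the ring axioms. *)
Definition fps_trunc (n : nat) f : {mpoly A[d]} :=
  \sum_(m : 'X_{1..d < n}) f m *: 'X_[m].

Lemma fps_truncE n f m : (mdeg m < n)%N -> (fps_trunc n f)@_m = f m.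
Proof. exact: mcoeff_mpoly. Qed.

Lemma mdeg_addm (n : nat) (m k1 k2 : 'X_{1..d}) : m = (k1 + k2)%MM ->
  (mdeg m < n)%N -> (mdeg k1 < n)%N /\ (mdeg k2 < n)%N.
Proof.
move=> -> lt_n; move: lt_n; rewrite mdegD => lt_n.
by split; apply: leq_ltn_trans lt_n; rewrite ?leq_addr ?leq_addl.
Qed.

Lemma fps_mul_trunc n f g m : (mdeg m < n)%N ->
  fps_mul f g m = (fps_trunc n f * fps_trunc n g)@_m.
Proof.
move=> lt_mn; rewrite mcoeffM /=; apply: eq_bigr => -[k1 k2] /= /eqP em.
by have [k1n k2n] := mdeg_addm em lt_mn; rewrite !fps_truncE.
Qed.

Fact fps_mulC : commutative fps_mul.
Proof.
move=> f g; apply: fpsP => m.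
by rewrite !(fps_mul_trunc _ _ (ltnSn _)) mulrC.
Qed.

Fact fps_mulA : associative fps_mul.
Proof.
move=> f g h; apply: fpsP => m; have [n lt_mn] : exists n, (mdeg m < n)%N.
  by exists (mdeg m).+1.
transitivity ((fps_trunc n f * (fps_trunc n g * fps_trunc n h))@_m).
  rewrite mcoeffM /=; apply: eq_bigr => -[k1 k2] /= /eqP em.
  have [k1n k2n] := mdeg_addm em lt_mn.
  by rewrite fps_truncE // -fps_mul_trunc.
rewrite mulrA mcoeffM /=; apply: eq_bigr => -[k1 k2] /= /eqP em.
have [k1n k2n] := mdeg_addm em lt_mn.
by rewrite fps_truncE // -fps_mul_trunc.
Qed.

Fact fps_mul1 : left_id fps_one fps_mul.
Proof.
move=> f; apply: fpsP => m; rewrite (fps_mul_trunc _ _ (ltnSn _)).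
suff -> : fps_trunc (mdeg m).+1 fps_one = 1 by rewrite mul1r fps_truncE.
apply/mpolyP => k; rewrite mcoeff1; have [kn|nk] := ltnP (mdeg k) (mdeg m).+1.
  by rewrite fps_truncE.
rewrite /fps_trunc (raddf_sum (mcoeff k)) big1 => [|i _]; first by case: eqP nk => // ->; rewrite mdeg0.
rewrite /= mcoeffZ mcoeffX; case: (bmnm i =P k) => [e|_]; last by rewrite mulr0.
by move: nk; rewrite -e leqNgt bmdeg.
Qed.

Fact fps_mulDl : left_distributive fps_mul fps_add.
Proof.
move=> f g h; apply: fpsP => m /=; rewrite -big_split /=.
by apply: eq_bigr => k _; rewrite mulrDl.
Qed.

Fact fps_1_neq0 : fps_one != 0.
Proof.
apply/eqP => /(congr1 (fun f : fps A d => f 0%MM)) /= /eqP.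
by rewrite eqxx oner_eq0.
Qed.

HB.instance Definition _ := GRing.Zmodule_isComNzRing.Build (fps A d)
  fps_mulA fps_mulC fps_mul1 fps_mulDl fps_1_neq0.

Fact fps_scaleA a b f : fps_scale a (fps_scale b f) = fps_scale (a * b) f.
Proof. by apply: fpsP => m /=; rewrite mulrA. Qed.
Fact fps_scale1 : left_id 1 fps_scale.
Proof. by move=> f; apply: fpsP => m /=; rewrite mul1r. Qed.
Fact fps_scaleDr : right_distributive fps_scale +%R.
Proof. by move=> a f g; apply: fpsP => m /=; rewrite mulrDr. Qed.
Fact fps_scaleDl f : {morph fps_scale^~ f : a b / a + b}.
Proof. by move=> a b; apply: fpsP => m /=; rewrite mulrDl. Qed.

HB.instance Definition _ := GRing.Zmodule_isLmodule.Build A (fps A d)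
  fps_scaleA fps_scale1 fps_scaleDr fps_scaleDl.

Definition fps_var (i : 'I_d) : fps A d := Fps (fun m => (m == U_(i)%MM)%:R).

(* The iterated partial derivative of multi-order [a]. *)
Definition fps_derivm (a : 'X_{1..d}) f : fps A d := Fps (fun m =>
  f (m + a)%MM *+ (\prod_(i < d) ((m + a)%MM i) ^_ (a i))%N).

(* First order partial derivative at the origin. *)
Definition fps_diff0 (i : 'I_d) f : A := fps_derivm U_(i)%MM f 0%MM.

(* All the terms of total degree [< k] of [f] are zero. *)
Definition vanish_order (k : nat) f : Prop :=
  forall m : 'X_{1..d}, (mdeg m < k)%N -> f m = 0.

End Ring.

(* Substitution of series [g i] without constant term into [f]; monomials of
   degree larger than [mdeg m] do not contribute to the coefficient of [m].
   It is only meaningful (and only used) when the [g i] have no constant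
   term. *)
Definition fps_subst (A : comNzRingType) (e d : nat)
    (f : fps A e) (g : 'I_e -> fps A d) : fps A d :=
  Fps (fun m => \sum_(a : 'X_{1..e < (mdeg m).+1})
                  f a * (\prod_(i < e) g i ^+ a i) m).

(* <a, b>_l; only meaningful for l <= m. *)
Definition herm (A : comNzRingType) (m l : nat) (a b : 'I_m -> A) : A :=
  \sum_(j < m) (-1) ^+ (j < l)%N * (a j * b j).

(** * Linear spans and dimensions in arbitrary vector spaces *)

Section Span.
Variables (K : fieldType) (V : lmodType K).
Local Open Scope classical_set_scope.

Definition lspan (S : set V) : set V :=
  [set v | exists k (c : 'I_k -> K) (u : 'I_k -> V),
     (forall j, S (u j)) /\ v = \sum_(j < k) c j *: u j].

Definition lin_indep (r : nat) (b : 'I_r -> V) : Prop :=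
  forall c : 'I_r -> K, \sum_(j < r) c j *: b j = 0 -> forall j, c j = 0.

Definition has_dim (W : set V) (r : nat) : Prop :=
  exists b : 'I_r -> V, lin_indep b /\ lspan (range b) = W.

End Span.

Section Complex.
Variable R : realType.
Local Notation C := R[i].
Local Open Scope classical_set_scope.

(** * Series in Z and its conjugate *)

(* A formal power series A(Z, Zbar), Z in C^d, is an element of
   [fps C (d + d)]: the first [d] variables are Z, the last [d] are Zbar. *)

Definition Zv d (i : 'I_d) : fps C (d + d) := fps_var C (lshift d i).
Definition Zb d (i : 'I_d) : fps C (d + d) := fps_var C (rshift d i).

(* Families indexed by the variables (x, y) in K^m x K^n. *)
Definition vcat (T : Type) (m n : nat) (x : 'I_m -> T) (y : 'I_n -> T)
    (i : 'I_(m + n)) : T :=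
  match split i with inl j => x j | inr j => y j end.

(* The conjugate series: conjugate the coefficients, exchange Z and Zbar. *)
Definition fps_conj d (f : fps C (d + d)) : fps C (d + d) :=
  fps_subst (Fps (fun m => (f m)^*)) (vcat (@Zb d) (@Zv d)).

Definition real_valued d (f : fps C (d + d)) : Prop := fps_conj f = f.

(* f(Z), seen as a series in (Z, Zbar). *)
Definition hol d (f : fps C d) : fps C (d + d) := fps_subst f (@Zv d).

(* The conjugate of f(Z), seen as a series in (Z, Zbar). *)
Definition ahol d (f : fps C d) : fps C (d + d) := fps_conj (hol f).

(* f(H(Z), conj H(Z)) *)
Definition pullback d e (f : fps C (e + e)) (H : 'I_e -> fps C d) :
    fps C (d + d) :=
  fps_subst f (vcat (fun i => hol (H i)) (fun i => ahol (H i))).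

(** * Rank, signature, and the classes H_k *)

(* The derivative of order [a] of A with respect to Zbar, at (Z, 0). *)
Definition dbar0 d (A : fps C (d + d)) (a : 'X_{1..d}) : fps C d :=
  fps_subst (fps_derivm [multinom vcat (fun=> 0%N) a i | i < d + d] A)
            (vcat (@fps_var C d) (fun=> 0)).

Definition VA d (A : fps C (d + d)) : set (fps C d) := lspan (range (dbar0 A)).

Definition has_rank d (A : fps C (d + d)) (r : nat) : Prop := has_dim (VA A) r.

Definition rank_le d (A : fps C (d + d)) (k : nat) : Prop :=
  exists2 r, (r <= k)%N & has_rank A r.

Definition is_signature d (A : fps C (d + d)) (s : nat) : Prop :=
  exists r (phi : 'I_r -> fps C d),
    [/\ has_rank A r, (s <= r)%N, lin_indep phi &
        A = herm s (fun j => hol (phi j)) (fun j => ahol (phi j))].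

(* For a real-valued A of finite rank there is exactly one [s] such that
   [is_signature A s]. *)
Definition signature d (A : fps C (d + d)) : nat :=
  xget 0%N [set s | is_signature A s].

Definition class_H d (k : nat) (A : fps C (d + d)) : Prop :=
  [/\ real_valued A, rank_le A k &
      forall f, VA A f -> forall m : 'X_{1..d}, (mdeg m <= 1)%N -> f m = 0].

(** * Formal hypersurfaces and embeddings *)

(* The series [fh_eq] is the expansion of the defining function in
   (Z - p, conj (Z - p)), where p is [fh_point]; similarly all maps and
   coordinates below are expanded in Z - p. *)
Record fgerm (d : nat) := FGerm {
  fh_point : 'cV[C]_d;
  fh_eq : fps C (d + d) }.

Definition formal_hypersurface d (M : fgerm d) : Prop :=
  [/\ real_valued (fh_eq M), fh_eq M 0%MM = 0 &
      exists i, fps_diff0 i (fh_eq M) != 0].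

(* Jacobian matrix at the base point. *)
Definition jacobian d e (H : 'I_e -> fps C d) : 'M[C]_(e, d) :=
  \matrix_(i, j) fps_diff0 j (H i).

(* The real tangent space, and its maximal complex subspace T \cap iT. *)
Definition tangent d (M : fgerm d) : set 'cV[C]_d :=
  [set v : 'cV[C]_d |
    \sum_(j < d) (fps_diff0 (lshift d j) (fh_eq M) * v j 0 +
                  fps_diff0 (rshift d j) (fh_eq M) * (v j 0)^*) = 0].

Definition ctangent d (M : fgerm d) : set 'cV[C]_d :=
  tangent M `&` [set 'i *: u | u in tangent M].

Definition formal_embedding d e (M : fgerm d) (M' : fgerm e)
    (H : 'I_e -> fps C d) : Prop :=
  [/\ forall i, H i 0%MM = 0,
      injective (fun v : 'cV[C]_d => jacobian H *m v) &
      exists q, pullback (fh_eq M') H = q * fh_eq M].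

Definition CR_transversal d e (M : fgerm d) (M' : fgerm e)
    (H : 'I_e -> fps C d) : Prop :=
  ~ ([set jacobian H *m v | v in tangent M] `<=` ctangent M').

Definition transversally_embeds d e (M : fgerm d) (M' : fgerm e) : Prop :=
  exists H : 'I_e -> fps C d,
    formal_embedding M M' H /\ CR_transversal M M' H.

(** * Equations in coordinates (z, w) in C^n x C *)

(* The coordinate w is the last of the [n.+1] coordinates. *)
Definition zv n (j : 'I_n) : fps C (n.+1 + n.+1) := Zv (widen_ord (leqnSn n) j).
Definition zb n (j : 'I_n) : fps C (n.+1 + n.+1) := Zb (widen_ord (leqnSn n) j).
Definition Re_w n : fps C (n.+1 + n.+1) :=
  2^-1 *: (Zv (@ord_max n) + Zb (@ord_max n)).
Definition Im_w n : fps C (n.+1 + n.+1) :=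
  (2 * 'i)^-1 *: (Zv (@ord_max n) - Zb (@ord_max n)).

(* The defining function Im w - <z, zbar>_l *)
Definition quadric_eq n l : fps C (n.+1 + n.+1) :=
  @Im_w n - herm l (@zv n) (@zb n).

(* The hyperquadric of signature [l] in C^{m+1}, at the origin. *)
Definition hyperquadric m l : fgerm m.+1 := FGerm 0 (quadric_eq m l).

(* Holomorphic coordinates vanishing at the base point. *)
Definition formal_coords d (Psi : 'I_d -> fps C d) : Prop :=
  (forall i, Psi i 0%MM = 0) /\ jacobian Psi \in unitmx.

(* In the coordinates [Psi], M is defined by [f = 0]: f(Psi, conj Psi) and the
   given defining function generate the same ideal. *)
Definition defined_by d (M : fgerm d) (Psi : 'I_d -> fps C d)
    (f : fps C (d + d)) : Prop :=
  (exists q, pullback f Psi = q * fh_eq M) /\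
  (exists q, fh_eq M = q * pullback f Psi).

(* B(z, zbar, Re w), for a series B in n + n + 1 variables. *)
Definition subst_z_Rew n (B : fps C (n + n + 1)) : fps C (n.+1 + n.+1) :=
  fps_subst B (vcat (vcat (@zv n) (@zb n)) (fun=> @Re_w n)).

Definition Levi_nondegenerate n (l : nat) (M : fgerm n.+1) : Prop :=
  exists Psi (B : fps C (n + n + 1)),
    [/\ formal_coords Psi, real_valued (subst_z_Rew B), vanish_order 3 B &
        defined_by M Psi (quadric_eq n l - subst_z_Rew B)].

(* In the formal coordinates [Psi] = (z, w), M is defined by
   Im w = <z, zbar>_l + A(z, zbar, w, wbar). *)
Definition normal_equation n (l : nat) (M : fgerm n.+1)
    (Psi : 'I_n.+1 -> fps C n.+1) (A : fps C (n.+1 + n.+1)) : Prop :=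
  [/\ formal_coords Psi, real_valued A, vanish_order 4 A &
      defined_by M Psi (quadric_eq n l - A)].

End Complex.

(* Main.v *)
From HB Require Import structures.
Require Import Defs.
From mathcomp Require Import all_boot all_order all_algebra.
From mathcomp Require Import boolp classical_sets reals.
From mathcomp Require Import complex mpoly.
From mathcomp Require Import sesquilinear spectral ring.

Set Implicit Arguments.
Unset Strict Implicit.
Unset Printing Implicit Defensive.

Import Order.TTheory GRing.Theory Num.Theory.
Local Open Scope ring_scope.

(** A map (F, G) sends M into the hyperquadric of signature l' when
    Im G - <F, F>_l' is a multiple of the equation of M. So if M is given by
    Im w = <z, z>_l + A with A = sum_j D_j |phi_j|^2, the map (z, phi, w) is an
    embedding, up to the order of the components and the sign of the equation.
    That a real-valued A of finite rank is such a sum is the spectral theorem,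
    applied to the hermitian matrix of the coefficients of A in a basis of V_A
    ([hermitian_sum_squares]). The choice of the signs gives
    [embedding_of_normal_equation].

    Conversely, let (F, G) be a transversal embedding. Comparing terms of low
    order with Im w = <z, z>_l + O(3) shows that G = a w + O(2) with a real and
    nonzero, and that the z-derivative of F multiplies the Levi form by a
    ([levi_identity]). Splitting the target orthogonally along the image of this
    derivative gives <F, F>_l' = a <f, f>_l + sum_j d_j |phi_j|^2 with
    f = z + O(2) up to terms in w, at most N - n series phi_j, and signs of the
    d_j controlled by the law of inertia ([form_splitting]). An isotropy of the
    hyperquadric removes the terms in w of f and phi ([parabolic]). Then
    (f, G / a) is a system of formal coordinates, in which the equation of M is
    Im w = <z, z>_l + sum_j (d_j / a) |phi_j|^2, and the phi_j have no constant
    or linear term ([normal_form]). Dividing by a exchanges the signs when a is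
    negative; this produces the maximum in the bound of the signature, and
    requires n - l <= l'.

    Signatures are bounded through the law of inertia: every representation of A
    as a sum of signed squares has at least S(A) negative ones
    ([sum_squares_inertia]).

    On the formal side, identities on substitutions are obtained by truncation
    to polynomials, and the inverse function theorem from a Neumann series
    ([subst_surj_id]). *)

(** * Formal power series *)

Section Ring.
Variables (A : comNzRingType) (d : nat).
Implicit Types f g h : fps A d.

Lemma fcoef1 m : (1 : fps A d) m = (m == 0%MM)%:R. Proof. by []. Qed.
Lemma fcoefD f g m : (f + g) m = f m + g m. Proof. by []. Qed.
Lemma fcoefN f m : (- f) m = - f m. Proof. by []. Qed.
Lemma fcoefB f g m : (f - g) m = f m - g m. Proof. by []. Qed.
Lemma fcoefZ (a : A) f m : (a *: f) m = a * f m. Proof. by []. Qed.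
Lemma fcoef_sum (I : Type) (r : seq I) (P : pred I) (F : I -> fps A d) m :
  (\sum_(i <- r | P i) F i) m = \sum_(i <- r | P i) F i m.
Proof. by elim/big_rec2: _ => // i y1 y2 _ <-. Qed.
Lemma fcoefM f g m : (f * g) m =
  \sum_(k : 'X_{1..d < (mdeg m).+1, (mdeg m).+1} | m == (k.1 + k.2)%MM)
    f k.1 * g k.2.
Proof. by []. Qed.
Lemma fcoef_var (i : 'I_d) (m : 'X_{1..d}) : fps_var A i m = (m == U_(i)%MM)%:R.
Proof. by []. Qed.

Lemma fps_scalerAl (a : A) f g : a *: (f * g) = a *: f * g.
Proof.
by apply: fpsP => m; rewrite fcoefM fcoefZ fcoefM mulr_sumr;
  apply: eq_bigr => k _; rewrite fcoefZ mulrA.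
Qed.
HB.instance Definition _ :=
  GRing.Lmodule_isLalgebra.Build A (fps A d) fps_scalerAl.
HB.instance Definition _ := GRing.Lalgebra_isComAlgebra.Build A (fps A d).

Lemma fcoef0M f g : (f * g) 0%MM = f 0%MM * g 0%MM.
Proof.
rewrite fcoefM (bigD1 (bm0, bm0)) /=; last by rewrite addm0.
rewrite big1 ?addr0 // => -[k1 k2] /= /andP[/eqP e /eqP []].
have /andP[/eqP e1 /eqP e2] : (bmnm k1 == 0%MM) && (bmnm k2 == 0%MM).
  by rewrite -!mdeg_eq0 -addn_eq0 -mdegD -e mdeg0.
by congr pair; apply/val_inj; rewrite /= ?e1 ?e2.
Qed.

Lemma vanish_order0 f : vanish_order 0 f. Proof. by []. Qed.
Lemma vanish_orderW k l f : (l <= k)%N -> vanish_order k f -> vanish_order l f.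
Proof. by move=> lk vf m ml; apply: vf; apply: leq_trans lk. Qed.
Lemma vanish_orderD k f g :
  vanish_order k f -> vanish_order k g -> vanish_order k (f + g).
Proof. by move=> vf vg m mk; rewrite fcoefD vf // vg // addr0. Qed.
Lemma vanish_orderN k f : vanish_order k f -> vanish_order k (- f).
Proof. by move=> vf m mk; rewrite fcoefN vf // oppr0. Qed.
Lemma vanish_orderZ k (a : A) f : vanish_order k f -> vanish_order k (a *: f).
Proof. by move=> vf m mk; rewrite fcoefZ vf // mulr0. Qed.
Lemma vanish_order_sum k (I : Type) (r : seq I) (P : pred I) (F : I -> fps A d) :
  (forall i, P i -> vanish_order k (F i)) ->
  vanish_order k (\sum_(i <- r | P i) F i).
Proof. by move=> vF m mk; rewrite fcoef_sum big1 // => i /vF ->. Qed.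

Lemma vanish_orderM k l f g :
  vanish_order k f -> vanish_order l g -> vanish_order (k + l) (f * g).
Proof.
move=> vf vg m mkl; rewrite fcoefM big1 // => -[k1 k2] /= /eqP e.
have [k1k|kk1] := ltnP (mdeg k1) k; first by rewrite vf ?mul0r.
rewrite vg ?mulr0 // ltnNge; apply/negP => lk2.
by move: mkl; rewrite e mdegD ltnNge leq_add.
Qed.

Lemma vanish_orderMr k f g : vanish_order k g -> vanish_order k (f * g).
Proof. by move=> vg; apply: (@vanish_orderM 0). Qed.
Lemma vanish_orderMl k f g : vanish_order k f -> vanish_order k (f * g).
Proof. by rewrite mulrC; apply: vanish_orderMr. Qed.

(** Together with the stability of [vanish_order] under the operations, this
    turns congruences modulo every order into equalities. *)
Lemma vanish_order_eq f g : (forall k, vanish_order k (f - g)) -> f = g.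
Proof.
by move=> v; apply: fpsP => m; apply/eqP; rewrite -subr_eq0 -fcoefB (v (mdeg m).+1).
Qed.

Lemma vanish_order1P f : vanish_order 1 f <-> f 0%MM = 0.
Proof.
split=> [v|f0 m]; first by apply: v; rewrite mdeg0.
by rewrite ltnS leqn0 mdeg_eq0 => /eqP ->.
Qed.

Lemma mdeg_lt2 (m : 'X_{1..d}) :
  (mdeg m < 2)%N -> m = 0%MM \/ exists i, m = U_(i)%MM.
Proof.
rewrite ltnS leq_eqVlt => /orP[/mdeg1P[i /eqP e]|]; first by right; exists i.
by rewrite ltnS leqn0 mdeg_eq0 => /eqP; left.
Qed.

Lemma vanish_order2P f :
  vanish_order 2 f <-> f 0%MM = 0 /\ forall i, f U_(i)%MM = 0.
Proof.
split=> [v|[f0 f1] m /mdeg_lt2[->|[i ->]]] //.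
by split=> [|i]; apply: v; rewrite ?mdeg0 ?mdeg1.
Qed.

Lemma fps_diff0E i f : fps_diff0 i f = f U_(i)%MM.
Proof.
rewrite /fps_diff0 /= add0m (bigD1 i) //= big1 => [|j ji].
  by rewrite mnm1E eqxx ffactn1 muln1 mulr1n.
by rewrite mnm1E eq_sym (negbTE ji) ffactn0.
Qed.

Definition linpart f : fps A d := \sum_i f U_(i)%MM *: fps_var A i.

Lemma fcoef_linpart f m : linpart f m = \sum_i f U_(i)%MM * (m == U_(i)%MM)%:R.
Proof. by rewrite fcoef_sum. Qed.

Lemma linpartP f : f 0%MM = 0 -> vanish_order 2 (f - linpart f).
Proof.
move=> f0; apply/vanish_order2P; split=> [|i]; rewrite fcoefB fcoef_linpart.
  by rewrite f0 big1 ?subr0 // => i _; rewrite eq_sym mnm1_eq0 mulr0.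
rewrite (bigD1 i) //= eqxx mulr1 big1 ?addr0 ?subrr // => j ji.
by rewrite eq_mnm1 eq_sym (negbTE ji) mulr0.
Qed.

(** Leibniz rule at the origin. *)
Lemma fcoefUM f g i :
  (f * g) U_(i)%MM = f 0%MM * g U_(i)%MM + f U_(i)%MM * g 0%MM.
Proof.
have dec h : exists h1 : fps A d,
    [/\ h = h1 + h 0%MM *: 1, h1 0%MM = 0 & h1 U_(i)%MM = h U_(i)%MM].
  exists (h - h 0%MM *: 1); split; first by rewrite subrK.
    by rewrite fcoefB fcoefZ fcoef1 eqxx mulr1 subrr.
  by rewrite fcoefB fcoefZ fcoef1 mnm1_eq0 mulr0 subr0.
have [f1 [ef f10 f1U]] := dec f; have [g1 [eg g10 g1U]] := dec g.
have -> : f * g =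
    f1 * g1 + (f 0%MM *: g1 + g 0%MM *: f1) + (f 0%MM * g 0%MM) *: 1.
  rewrite {1}ef {1}eg mulrDl !mulrDr -!scalerAl -!scalerAr !mul1r mulr1.
  by rewrite scalerA [f 0%MM *: g1 + _]addrC !addrA.
rewrite !fcoefD !fcoefZ f1U g1U fcoef1 mnm1_eq0 mulr0 addr0.
have /vanish_order2P[_ ->] : vanish_order 2 (f1 * g1).
  by apply: (@vanish_orderM 1 1); apply/vanish_order1P.
by rewrite add0r [g 0%MM * _]mulrC.
Qed.

Definition fps_mon (a : 'X_{1..d}) : fps A d := Fps (fun m => (m == a)%:R).

Lemma fps_mon0 : fps_mon 0%MM = 1. Proof. by apply: fpsP. Qed.
Lemma fps_monU (i : 'I_d) : fps_mon U_(i)%MM = fps_var A i. Proof. by apply: fpsP. Qed.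

Lemma fcoef_monM a f m : (fps_mon a * f) (a + m)%MM = f m.
Proof.
have ha : (mdeg a < (mdeg (a + m)).+1)%N by rewrite ltnS mdegD leq_addr.
have hm : (mdeg m < (mdeg (a + m)).+1)%N by rewrite ltnS mdegD leq_addl.
rewrite fcoefM (bigD1 (BMultinom ha, BMultinom hm)) //=.
rewrite eqxx mul1r big1 ?addr0 // => -[k1 k2] /= /andP[/eqP e ne].
case: eqP => [e1|]; last by rewrite mul0r.
case/eqP: ne; congr pair; apply/val_inj => //=.
by apply: (@addmI _ a); rewrite -[X in (X + k2)%MM]e1; apply/esym.
Qed.

Lemma fcoef_monM0 a f m : ~~ (a <= m)%MM -> (fps_mon a * f) m = 0.
Proof.
move=> n; rewrite fcoefM big1 // => -[k1 k2] /= /eqP e.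
by case: eqP => [e1|]; rewrite ?mul0r //; case/negP: n; rewrite e e1 lem_addr.
Qed.

Lemma fps_monM a b : fps_mon a * fps_mon b = fps_mon (a + b)%MM.
Proof.
apply: fpsP => m; have [/submK <-|le] := boolP (a <= m)%MM.
  by rewrite addmC fcoef_monM /= eqm_add2l.
rewrite fcoef_monM0 //=; case: eqP le => // ->.
by rewrite lem_addr.
Qed.

Lemma fps_mon_prod (I : Type) (r : seq I) (P : pred I) (F : I -> 'X_{1..d}) :
  \prod_(i <- r | P i) fps_mon (F i) =
    fps_mon (\big[+%MM/0%MM]_(i <- r | P i) F i).
Proof.
by elim/big_rec2: _ => [|i y1 y2 _ ->]; rewrite ?fps_mon0 // fps_monM.
Qed.
Lemma fps_monX a n : fps_mon a ^+ n = fps_mon (a *+ n)%MM.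
Proof.
by elim: n => [|n IHn]; rewrite ?expr0 ?mulm0n ?fps_mon0 // exprS IHn fps_monM mulmS.
Qed.

Lemma prod_varE (a : 'X_{1..d}) : \prod_i fps_var A i ^+ a i = fps_mon a.
Proof.
transitivity (\prod_i fps_mon (U_(i) *+ a i)%MM).
  by apply: eq_bigr => i _; rewrite -fps_monU fps_monX.
by rewrite fps_mon_prod -multinomUE_id.
Qed.

End Ring.

Lemma fcoef0_var (A : comNzRingType) d (i : 'I_d) : fps_var A i 0%MM = 0.
Proof. by rewrite fcoef_var eq_sym mnm1_eq0. Qed.

(** * Substitution *)

Definition nocst (A : comNzRingType) (d e : nat) (g : 'I_e -> fps A d) : Prop :=
  forall i, g i 0%MM = 0.

Section Subst.
Variables (A : comNzRingType) (e d : nat).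
Implicit Types (f h : fps A e) (g : 'I_e -> fps A d).

Lemma vanish_prodX g (a : 'X_{1..e}) :
  nocst g -> vanish_order (mdeg a) (\prod_i g i ^+ a i).
Proof.
move=> g0; rewrite mdegE; elim/big_rec2: _ => [|i k x _ vx].
  exact: vanish_order0.
apply: vanish_orderM => //; elim: (a i) => [|l IHl]; first exact: vanish_order0.
by rewrite exprS -add1n; apply: vanish_orderM => //; apply/vanish_order1P.
Qed.

(** Evaluation of a polynomial at series. It is a ring morphism, and [fps_subst]
    agrees with it on truncations up to any given order: the terms of degree k
    contribute from order k on, since the series substituted have no constant
    term. *)
Definition poly_subst g (p : {mpoly A[e]}) : fps A d :=
  mmap (GRing.in_alg (fps A d)) g p.

Lemma vanish_poly_subst k g (p : {mpoly A[e]}) : nocst g ->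
  (forall a, (mdeg a < k)%N -> p@_a = 0) -> vanish_order k (poly_subst g p).
Proof.
move=> g0 p0; rewrite /poly_subst /mmap big_seq.
apply: vanish_order_sum => a; rewrite mcoeff_msupp => pa.
apply: vanish_orderMr; apply: (vanish_orderW _ (@vanish_prodX g a g0)).
by rewrite leqNgt; apply: contraNN pa => /p0 ->.
Qed.

Lemma poly_subst_trunc g n f : poly_subst g (fps_trunc n f) =
  \sum_(a : 'X_{1..e < n}) f a *: \prod_i g i ^+ a i.
Proof.
rewrite /poly_subst raddf_sum; apply: eq_bigr => a _ /=.
by rewrite mmapZ mmapX /= mulr_algl.
Qed.

Lemma fcoef_subst f g m : nocst g ->
  fps_subst f g m = poly_subst g (fps_trunc (mdeg m).+1 f) m.
Proof. by move=> g0; rewrite poly_subst_trunc fcoef_sum. Qed.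

Lemma subst_poly_congr f g p n : nocst g ->
  (forall a, (mdeg a < n)%N -> p@_a = f a) ->
  vanish_order n (fps_subst f g - poly_subst g p).
Proof.
move=> g0 pf m mn; rewrite fcoefB fcoef_subst // -fcoefB /poly_subst -mmapB.
apply: (@vanish_poly_subst (mdeg m).+1) => // a am.
by rewrite mcoeffB fps_truncE // pf ?subrr // (leq_trans am).
Qed.

Lemma subst_trunc f g n : nocst g ->
  vanish_order n (fps_subst f g - poly_subst g (fps_trunc n f)).
Proof. by move=> g0; apply: subst_poly_congr => // a; apply: fps_truncE. Qed.

Lemma subst_poly p g : nocst g -> fps_subst (Fps (fun m => p@_m)) g = poly_subst g p.
Proof.
by move=> g0; apply: vanish_order_eq => k; apply: subst_poly_congr.
Qed.

Lemma substD g : {morph (fun f => fps_subst f g) : f h / f + h}.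
Proof.
move=> f h; apply: fpsP => m; rewrite fcoefD /= -big_split /=.
by apply: eq_bigr => a _; rewrite mulrDl.
Qed.

Lemma substZ g c f : fps_subst (c *: f) g = c *: fps_subst f g.
Proof.
apply: fpsP => m; rewrite fcoefZ /= mulr_sumr.
by apply: eq_bigr => a _; rewrite mulrA.
Qed.

Lemma substN g f : fps_subst (- f) g = - fps_subst f g.
Proof. by rewrite -scaleN1r substZ scaleN1r. Qed.
Lemma substB g : {morph (fun f => fps_subst f g) : f h / f - h}.
Proof. by move=> f h; rewrite substD substN. Qed.
Lemma subst0 g : fps_subst 0 g = 0.
Proof. by rewrite -(scale0r 0) substZ scale0r. Qed.

Lemma subst_sum g (I : Type) (r : seq I) (P : pred I) F :
  fps_subst (\sum_(i <- r | P i) F i) g = \sum_(i <- r | P i) fps_subst (F i) g.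
Proof. by apply: (big_morph (fun f => fps_subst f g)); [apply: substD|apply: subst0]. Qed.

Lemma subst1 g : nocst g -> fps_subst 1 g = 1.
Proof.
move=> g0; have -> : 1 = Fps (fun m => (1 : {mpoly A[e]})@_m).
  by apply: fpsP => m; rewrite fcoef1 /= mcoeff1.
by rewrite subst_poly // /poly_subst rmorph1.
Qed.

Lemma subst_var g i : nocst g -> fps_subst (fps_var A i) g = g i.
Proof.
move=> g0; have -> : fps_var A i = Fps (fun m => ('X_i : {mpoly A[e]})@_m).
  by apply: fpsP => m; rewrite fcoef_var /= mcoeffX eq_sym.
by rewrite subst_poly // /poly_subst mmapX mmap1U.
Qed.

Lemma vanish_congrM n (x x' y y' : fps A d) :
  vanish_order n (x - x') -> vanish_order n (y - y') ->
  vanish_order n (x * y - x' * y').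
Proof.
move=> vx vy; have -> : x * y - x' * y' = x * (y - y') + (x - x') * y'.
  by rewrite mulrBr mulrBl addrA subrK.
by apply: vanish_orderD; [apply: vanish_orderMr|apply: vanish_orderMl].
Qed.

Lemma vanish_sym n (x y : fps A d) : vanish_order n (x - y) -> vanish_order n (y - x).
Proof. by move=> v; rewrite -opprB; apply: vanish_orderN. Qed.
Lemma vanish_trans n (x y z : fps A d) :
  vanish_order n (x - y) -> vanish_order n (y - z) -> vanish_order n (x - z).
Proof. by move=> v w; rewrite -(subrKA y); apply: vanish_orderD. Qed.

Lemma substM g : nocst g -> {morph (fun f => fps_subst f g) : f h / f * h}.
Proof.
move=> g0 f h; apply: vanish_order_eq => n.
apply: (@vanish_trans n _ (poly_subst g (fps_trunc n f * fps_trunc n h))).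
  by apply: subst_poly_congr => // a /fps_mul_trunc ->.
apply: vanish_sym; rewrite /poly_subst rmorphM.
by apply: vanish_congrM; apply: subst_trunc.
Qed.

Lemma substX g f n : nocst g -> fps_subst (f ^+ n) g = fps_subst f g ^+ n.
Proof.
by move=> g0; elim: n => [|n IHn]; rewrite ?expr0 ?subst1 // !exprS substM ?IHn.
Qed.

Lemma subst_prod g (I : Type) (r : seq I) (P : pred I) F : nocst g ->
  fps_subst (\prod_(i <- r | P i) F i) g = \prod_(i <- r | P i) fps_subst (F i) g.
Proof.
by move=> g0; apply: (big_morph (fun f => fps_subst f g));
  [apply: substM|apply: subst1].
Qed.

Lemma vanish_subst k f g : nocst g -> vanish_order k f -> vanish_order k (fps_subst f g).
Proof.
move=> g0 vf; have := @subst_poly_congr f g 0 k g0.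
rewrite /poly_subst rmorph0 subr0; apply => a ak.
by rewrite mcoeff0 vf.
Qed.

Lemma fcoef0_subst f g : nocst g -> fps_subst f g 0%MM = f 0%MM.
Proof.
move=> g0; rewrite -[X in fps_subst X g](subrK (f 0%MM *: 1)) substD substZ subst1 //.
rewrite fcoefD fcoefZ fcoef1 eqxx mulr1 [X in X + _](_ : _ = 0) ?add0r //.
apply/vanish_order1P/vanish_subst => //; apply/vanish_order1P.
by rewrite fcoefB fcoefZ fcoef1 eqxx mulr1 subrr.
Qed.

Lemma nocst_subst k (f : 'I_k -> fps A e) g :
  nocst g -> nocst f -> nocst (fun i => fps_subst (f i) g).
Proof. by move=> g0 f0 i; rewrite fcoef0_subst. Qed.

(** Chain rule at the origin: the terms of order at least 2 stay of order at
    least 2. *)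
Lemma fcoefU_subst f g j : nocst g ->
  fps_subst f g U_(j)%MM = \sum_i f U_(i)%MM * g i U_(j)%MM.
Proof.
move=> g0; pose f1 := f - f 0%MM *: 1.
have f10 : f1 0%MM = 0 by rewrite fcoefB fcoefZ fcoef1 eqxx mulr1 subrr.
have f1U i : f1 U_(i)%MM = f U_(i)%MM.
  by rewrite fcoefB fcoefZ fcoef1 mnm1_eq0 mulr0 subr0.
have {1}-> : f = (f1 - linpart f1) + linpart f1 + f 0%MM *: 1 by rewrite subrK subrK.
rewrite 2!substD substZ subst1 // 2!fcoefD fcoefZ fcoef1 mnm1_eq0 mulr0 addr0.
have /vanish_order2P[_ ->] := vanish_subst g0 (linpartP f10).
rewrite add0r /linpart subst_sum fcoef_sum; apply: eq_bigr => i _.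
by rewrite substZ subst_var // fcoefZ f1U.
Qed.
End Subst.

Lemma eq_subst (A : comNzRingType) e d (f : fps A e) (g g' : 'I_e -> fps A d) :
  g =1 g' -> fps_subst f g = fps_subst f g'.
Proof. by move=> /funext ->. Qed.

Lemma subst_assoc (A : comNzRingType) c e d (f : fps A c)
    (g : 'I_c -> fps A e) (h : 'I_e -> fps A d) : nocst g -> nocst h ->
  fps_subst (fps_subst f g) h = fps_subst f (fun i => fps_subst (g i) h).
Proof.
move=> g0 h0; apply: vanish_order_eq => n.
apply: (@vanish_trans _ _ n _ (fps_subst (poly_subst g (fps_trunc n f)) h)).
  by rewrite -substB; apply: vanish_subst => //; apply: subst_trunc.
apply: vanish_sym; have := @subst_trunc _ _ _ f _ n (nocst_subst h0 g0).
rewrite !poly_subst_trunc subst_sum; congr (vanish_order _ (_ - _)).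
apply: eq_bigr => a _; rewrite substZ subst_prod //; congr (_ *: _).
by apply: eq_bigr => i _; rewrite substX.
Qed.

Lemma subst_id (A : comNzRingType) d (f : fps A d) :
  fps_subst f (fun i => fps_var A i) = f.
Proof.
apply: fpsP => m /=; rewrite (bigD1 (BMultinom (ltnSn (mdeg m)))) //=.
rewrite prod_varE /= eqxx mulr1 big1 ?addr0 // => a ne.
rewrite prod_varE /=; case: eqP => [e|]; rewrite ?mulr0 //.
by case/eqP: ne; apply: val_inj.
Qed.

(** * Units and the inverse function theorem *)

(** The geometric series, from which [fps_unit] gets the inverse of 1 - h by
    substitution of h. *)
Lemma fps_geom (A : comNzRingType) :
  (1 - fps_var A (@ord0 0)) * Fps (fun=> 1) = 1 :> fps A 1.
Proof.
apply: fpsP => m; rewrite mulrBl mul1r fcoefB fcoef1 -fps_monU.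
have [le|nle] := boolP (U_(ord0) <= m)%MM.
  rewrite -[in X in _ - X](submK le) addmC fcoef_monM subrr.
  by case: eqP le => // ->; rewrite lep1mP mnm0E.
rewrite fcoef_monM0 // subr0; case: eqP => // /eqP ne.
by case/negP: nle; rewrite lep1mP; apply: contraNN ne => /eqP e;
  apply/eqP/mnmP => i; rewrite mnm0E (ord1 i).
Qed.

Lemma fps_unit (F : fieldType) d (f : fps F d) :
  f 0%MM != 0 -> exists g, f * g = 1.
Proof.
move=> f0; pose h : fps F d := 1 - (f 0%MM)^-1 *: f.
have h0 : nocst (fun _ : 'I_1 => h).
  by move=> _; rewrite fcoefB fcoefZ fcoef1 eqxx mulVf ?subrr.
exists ((f 0%MM)^-1 *: fps_subst (Fps (fun=> 1)) (fun _ : 'I_1 => h)).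
have /(congr1 (fun x => fps_subst x (fun _ : 'I_1 => h))) := fps_geom F.
rewrite substM // substB subst1 // subst_var // => e.
by rewrite -scalerAr scalerAl -e /h subKr.
Qed.

Section Inverse.
Variables (A : comNzRingType) (d : nat).
Implicit Types (f : fps A d) (g : 'I_d -> fps A d).

Lemma vanish_prod_congr g (a : 'X_{1..d}) : nocst g ->
  (forall i, vanish_order 2 (g i - fps_var A i)) ->
  vanish_order (mdeg a).+1 (\prod_i g i ^+ a i - fps_mon A a).
Proof.
move=> g0 g1; rewrite -prod_varE.
pose P k (x y : fps A d) :=
  [/\ vanish_order k x, vanish_order k y & vanish_order k.+1 (x - y)].
have PM k l x y z t : P k x y -> P l z t -> P (k + l)%N (x * z) (y * t).
  move=> [vx vy vxy] [vz vt vzt]; split; [exact: vanish_orderM..|].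
  have -> : x * z - y * t = x * (z - t) + (x - y) * t.
    by rewrite mulrBr mulrBl addrA subrK.
  apply: vanish_orderD; first by rewrite -addnS; apply: vanish_orderM.
  by rewrite -addSn; apply: vanish_orderM.
have P1 : P 0 1 1 by split; rewrite ?subrr //; apply: vanish_order0.
suff [] : P (mdeg a) (\prod_i g i ^+ a i) (\prod_i fps_var A i ^+ a i) by [].
rewrite mdegE; elim/big_rec3: _ => // i x y k _ Pk.
apply: (PM) => //; elim: (a i) => [|n IHn]; first by rewrite !expr0.
rewrite !exprS -add1n; apply: (PM) => //; split => //.
  by apply/vanish_order1P; apply: g0.
by apply/vanish_order1P; rewrite fcoef_var eq_sym mnm1_eq0.
Qed.

(** Substituting a map tangent to the identity changes a series only beyond its
    order. The operator f - f(g) is thus contracting for the order topology. *)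
Lemma vanish_subst_congr k f g : nocst g ->
  (forall i, vanish_order 2 (g i - fps_var A i)) ->
  vanish_order k f -> vanish_order k.+1 (f - fps_subst f g).
Proof.
move=> g0 g1 vf m mk; rewrite -[X in X - _]subst_id fcoefB -sumrB big1 // => a _.
rewrite -mulrBr prod_varE -fcoefB.
have [ak|ka] := ltnP (mdeg a) k; first by rewrite vf ?mul0r.
rewrite (vanish_sym (vanish_prod_congr g0 g1)) ?mulr0 //.
by apply: leq_trans mk _.
Qed.

(** The solution is the Neumann series of the contracting operator N, which
    sends f to f - f(g). *)
Lemma subst_surj_id g : nocst g ->
  (forall i, vanish_order 2 (g i - fps_var A i)) ->
  forall f, exists f', fps_subst f' g = f.
Proof.
move=> g0 g1 f; pose N x := x - fps_subst x g.
have vN k : vanish_order k (iter k N f).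
  by elim: k => // k IHk; apply: vanish_subst_congr.
(* N raises the order, so that the coefficient of m in the Neumann series is
   already that of its partial sum of index mdeg m + 1. *)
pose S n := \sum_(i < n) iter i N f.
exists (Fps (fun m => S (mdeg m).+1 m)).
have SE n : vanish_order n (Fps (fun m => S (mdeg m).+1 m) - S n).
  move=> m mn; rewrite fcoefB /= /S !fcoef_sum -(subnKC mn) big_split_ord /=.
  by rewrite opprD addrA subrr sub0r big1 ?oppr0 // => i _;
    exact: (vN ((mdeg m).+1 + i)%N m (leq_addr _ _)).
have tel n : fps_subst (S n) g = f - iter n N f.
  elim: n => [|n IHn]; first by rewrite /S big_ord0 subst0 subrr.
  by rewrite /S big_ord_recr substD /= -/(S n) IHn [N _]/N opprB addrAC addrA.
apply: vanish_order_eq => n; apply: (@vanish_trans _ _ _ _ (fps_subst (S n) g)).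
  by rewrite -substB; apply: vanish_subst.
by rewrite tel addrAC subrr add0r; apply: vanish_orderN.
Qed.
End Inverse.

(** Composition with the inverse of the linear part reduces the problem to a map
    tangent to the identity. *)
Lemma subst_surj (F : fieldType) d (g : 'I_d -> fps F d) : nocst g ->
  (\matrix_(i, j) g i U_(j)%MM) \in unitmx ->
  forall f, exists f', fps_subst f' g = f.
Proof.
set J := \matrix_(i, j) _ => g0 Ju f.
pose L i : fps F d := \sum_j (invmx J) i j *: fps_var F j.
have L0 : nocst L.
  by move=> i; rewrite fcoef_sum big1 // => j _; rewrite fcoefZ fcoef0_var mulr0.
have LgE i : fps_subst (L i) g = \sum_j (invmx J) i j *: g j.
  by rewrite subst_sum; apply: eq_bigr => j _; rewrite substZ subst_var.
have Lg1 i : vanish_order 2 (fps_subst (L i) g - fps_var F i).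
  apply/vanish_order2P; split=> [|j].
    by rewrite fcoefB fcoef0_subst // L0 fcoef0_var subrr.
  rewrite fcoefB LgE fcoef_sum fcoef_var eq_mnm1 eq_sym.
  have := congr1 (fun M : 'M_d => M i j) (mulVmx Ju); rewrite !mxE => <-.
  rewrite -sumrB big1 // => k _.
  by rewrite fcoefZ mxE subrr.
have [f' <-] := subst_surj_id (nocst_subst g0 L0) Lg1 f.
by exists (fps_subst f' L); rewrite subst_assoc.
Qed.

(** A left inverse has itself a left inverse, hence is two-sided. *)
Lemma formal_inverse (F : fieldType) d (g : 'I_d -> fps F d) : nocst g ->
  (\matrix_(i, j) g i U_(j)%MM) \in unitmx ->
  exists h : 'I_d -> fps F d,
    [/\ nocst h, forall i, fps_subst (h i) g = fps_var F i &
        forall i, fps_subst (g i) h = fps_var F i].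
Proof.
have left_inv (f : 'I_d -> fps F d) : nocst f ->
    (\matrix_(i, j) f i U_(j)%MM) \in unitmx ->
    exists h, [/\ nocst h, forall i, fps_subst (h i) f = fps_var F i &
      (\matrix_(i, j) h i U_(j)%MM) \in unitmx].
  move=> f0 Ju; have /choice[h hf] := fun i => subst_surj f0 Ju (fps_var F i).
  exists h; split=> //.
    by move=> i; rewrite -(fcoef0_subst (h i) f0) hf fcoef0_var.
  suff /mulmx1_unit[] : (\matrix_(i, j) h i U_(j)%MM) *m
    (\matrix_(i, j) f i U_(j)%MM) = 1%:M by [].
  apply/matrixP => i j; rewrite !mxE.
  have := congr1 (fun x : fps F d => x U_(j)%MM) (hf i).
  rewrite fcoefU_subst // fcoef_var eq_mnm1 eq_sym => <-.
  by apply: eq_bigr => l _; rewrite !mxE.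
move=> g0 gu; have [h [h0 hg hu]] := left_inv g g0 gu.
have [k [k0 kh _]] := left_inv h h0 hu.
exists h; split=> // i.
have -> : g i = k i; last exact: kh.
transitivity (fps_subst (fps_subst (k i) h) g).
  by rewrite kh subst_var.
rewrite subst_assoc // -[RHS]subst_id; apply: eq_subst => j; exact: hg.
Qed.

(** * Series in Z and its conjugate *)

Lemma vcatl (T : Type) m n (x : 'I_m -> T) (y : 'I_n -> T) i :
  vcat x y (lshift n i) = x i.
Proof. by rewrite /vcat (unsplitK (inl i)). Qed.
Lemma vcatr (T : Type) m n (x : 'I_m -> T) (y : 'I_n -> T) i :
  vcat x y (rshift m i) = y i.
Proof. by rewrite /vcat (unsplitK (inr i)). Qed.

Lemma vcat_ind (T : Type) (P : T -> Prop) m n (x : 'I_m -> T) (y : 'I_n -> T) :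
  (forall i, P (x i)) -> (forall i, P (y i)) -> forall i, P (vcat x y i).
Proof. by move=> Px Py i; case: (split_ordP i) => j ->; rewrite ?vcatl ?vcatr. Qed.

(** Exponents in (Z, Zbar) are pairs of exponents. *)
Definition mcat m n (a : 'X_{1..m}) (b : 'X_{1..n}) : 'X_{1..m + n} :=
  [multinom vcat a b i | i < m + n].

Section Mcat.
Variables m n : nat.
Implicit Types (a : 'X_{1..m}) (b : 'X_{1..n}).

Lemma mcatl a b i : mcat a b (lshift n i) = a i.
Proof. by rewrite mnmE vcatl. Qed.
Lemma mcatr a b i : mcat a b (rshift m i) = b i.
Proof. by rewrite mnmE vcatr. Qed.

Lemma mcat_inj a b a' b' : mcat a b = mcat a' b' -> a = a' /\ b = b'.
Proof.
move/mnmP => e; split; apply/mnmP => i.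
  by have := e (lshift n i); rewrite !mcatl.
by have := e (rshift m i); rewrite !mcatr.
Qed.
Lemma eq_mcat a b a' b' : (mcat a b == mcat a' b') = (a == a') && (b == b').
Proof. by apply/eqP/andP => [/mcat_inj[-> ->]|[/eqP-> /eqP->]]. Qed.

Lemma mcatD a b a' b' : (mcat a b + mcat a' b')%MM = mcat (a + a')%MM (b + b')%MM.
Proof.
by apply/mnmP => i; case: (split_ordP i) => j ->;
  rewrite mnmDE ?mcatl ?mcatr mnmDE.
Qed.
Lemma mcatUl (i : 'I_m) : mcat U_(i) 0%MM = U_(lshift n i)%MM.
Proof.
by apply/mnmP => k; case: (split_ordP k) => j ->;
  rewrite ?mcatl ?mcatr ?mnm1E ?mnm0E ?eq_lshift ?eq_lrshift.
Qed.
Lemma mcatUr (i : 'I_n) : mcat 0%MM U_(i) = U_(rshift m i)%MM.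
Proof.
by apply/mnmP => k; case: (split_ordP k) => j ->;
  rewrite ?mcatl ?mcatr ?mnm1E ?mnm0E ?eq_rshift ?eq_rlshift.
Qed.
Lemma mcatP (k : 'X_{1..m + n}) : exists a b, k = mcat a b.
Proof.
exists [multinom k (lshift n i) | i < m], [multinom k (rshift m i) | i < n].
by apply/mnmP => i; case: (split_ordP i) => j ->; rewrite ?mcatl ?mcatr !mnmE.
Qed.
Lemma mdeg_mcat a b : mdeg (mcat a b) = (mdeg a + mdeg b)%N.
Proof.
rewrite !mdegE big_split_ord /=.
by congr (_ + _)%N; apply: eq_bigr => i _; rewrite ?mcatl ?mcatr.
Qed.
End Mcat.

Section Conj.
Variable C : numClosedFieldType.

Definition zvar d (i : 'I_d) : fps C (d + d) := fps_var C (lshift d i).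
Definition zbar d (i : 'I_d) : fps C (d + d) := fps_var C (rshift d i).

Definition cmap d (f : fps C d) : fps C d := Fps (fun m => (f m)^*).

(** Here [sconj], [holo], [aholo], [pull] and [bar_deriv] are [fps_conj], [hol],
    [ahol], [pullback] and [dbar0] over an arbitrary algebraically closed field
    with a conjugation. *)

Definition sconj d (f : fps C (d + d)) : fps C (d + d) :=
  fps_subst (cmap f) (vcat (@zbar d) (@zvar d)).
Definition holo d (f : fps C d) : fps C (d + d) := fps_subst f (@zvar d).
Definition aholo d (f : fps C d) : fps C (d + d) := sconj (holo f).
Definition pull d e (f : fps C (e + e)) (H : 'I_e -> fps C d) : fps C (d + d) :=
  fps_subst f (vcat (fun i => holo (H i)) (fun i => aholo (H i))).
Definition bar_deriv d (A : fps C (d + d)) (a : 'X_{1..d}) : fps C d :=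
  fps_subst (fps_derivm (mcat 0%MM a) A) (vcat (@fps_var C d) (fun=> 0)).

Section Cmap.
Variable d : nat.
Implicit Types f g : fps C d.
Lemma cmapD : {morph @cmap d : f g / f + g}.
Proof. by move=> f g; apply: fpsP => m; rewrite /= rmorphD. Qed.
Lemma cmapM : {morph @cmap d : f g / f * g}.
Proof.
move=> f g; apply: fpsP => m; rewrite [LHS]/= !fcoefM rmorph_sum.
by apply: eq_bigr => k _; rewrite rmorphM.
Qed.
Lemma cmap1 : cmap 1 = 1 :> fps C d.
Proof. by apply: fpsP => m; rewrite /= rmorph_nat. Qed.
Lemma cmapX f n : cmap (f ^+ n) = cmap f ^+ n.
Proof. by elim: n => [|n IHn]; rewrite ?expr0 ?cmap1 // !exprS cmapM IHn. Qed.
Lemma cmap_prod (I : Type) (r : seq I) (P : pred I) (F : I -> fps C d) :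
  cmap (\prod_(i <- r | P i) F i) = \prod_(i <- r | P i) cmap (F i).
Proof. by apply: big_morph; [apply: cmapM|apply: cmap1]. Qed.
Lemma cmap_var i : cmap (fps_var C i) = fps_var C i :> fps C d.
Proof. by apply: fpsP => m; rewrite /= rmorph_nat. Qed.
Lemma cmapK : involutive (@cmap d).
Proof. by move=> f; apply: fpsP => m; rewrite /= conjCK. Qed.
Lemma nocst_cmap e (g : 'I_e -> fps C d) : nocst g -> nocst (fun i => cmap (g i)).
Proof. by move=> g0 i; rewrite /= g0 rmorph0. Qed.
End Cmap.

Lemma cmap_subst e d (f : fps C e) (g : 'I_e -> fps C d) :
  cmap (fps_subst f g) = fps_subst (cmap f) (fun i => cmap (g i)).
Proof.
apply: fpsP => m /=; rewrite rmorph_sum; apply: eq_bigr => a _ /=.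
rewrite rmorphM -[X in _ * X]/(cmap _ m); congr (_ * fcoef _ m).
rewrite cmap_prod; apply: eq_bigr => i _.
by rewrite cmapX.
Qed.

Lemma nocst_zvar d : nocst (@zvar d).
Proof. by move=> i; apply: fcoef0_var. Qed.
Lemma nocst_zbar d : nocst (@zbar d).
Proof. by move=> i; apply: fcoef0_var. Qed.
Lemma nocst_vcat d (m n : nat) (x : 'I_m -> fps C d) (y : 'I_n -> fps C d) :
  nocst x -> nocst y -> nocst (vcat x y).
Proof. by move=> x0 y0; apply: (@vcat_ind _ (fun h : fps C d => h 0%MM = 0)). Qed.

Section Hol.
Variable d : nat.
Implicit Types (f g : fps C d) (A B : fps C (d + d)).

Lemma nocst_swap : nocst (vcat (@zbar d) (@zvar d)).
Proof. by apply: nocst_vcat; [apply: nocst_zbar|apply: nocst_zvar]. Qed.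
Hint Resolve nocst_swap nocst_zvar nocst_zbar : core.

Lemma sconjD : {morph @sconj d : A B / A + B}.
Proof. by move=> A B; rewrite /sconj cmapD substD. Qed.
Lemma sconjM : {morph @sconj d : A B / A * B}.
Proof. by move=> A B; rewrite /sconj cmapM substM. Qed.
Lemma sconjZ (c : C) A : sconj (c *: A) = c^* *: sconj A.
Proof.
rewrite /sconj -substZ; congr fps_subst.
by apply: fpsP => m /=; rewrite rmorphM.
Qed.
Lemma sconj0 : @sconj d 0 = 0.
Proof. by have := sconjZ 0 0; rewrite scale0r rmorph0 scale0r. Qed.
Lemma sconj_sum (I : Type) (r : seq I) (P : pred I) (F : I -> fps C (d + d)) :
  sconj (\sum_(i <- r | P i) F i) = \sum_(i <- r | P i) sconj (F i).
Proof. by apply: big_morph; [apply: sconjD|apply: sconj0]. Qed.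

Lemma sconj_subst e (f : fps C e) (g : 'I_e -> fps C (d + d)) : nocst g ->
  sconj (fps_subst f g) = fps_subst (cmap f) (fun i => sconj (g i)).
Proof.
by move=> g0; rewrite {1}/sconj cmap_subst
  subst_assoc //; apply: nocst_cmap.
Qed.

Lemma sconj_zvar i : sconj (zvar i) = @zbar d i.
Proof. by rewrite /sconj cmap_var subst_var // vcatl. Qed.
Lemma sconj_zbar i : sconj (zbar i) = @zvar d i.
Proof. by rewrite /sconj cmap_var subst_var // vcatr. Qed.

Lemma aholoE f : aholo f = fps_subst (cmap f) (@zbar d).
Proof.
by rewrite /aholo /holo sconj_subst //; apply: eq_subst => i; rewrite sconj_zvar.
Qed.

Lemma sconjK : involutive (@sconj d).
Proof.
move=> A; rewrite {2}/sconj sconj_subst // cmapK -[RHS]subst_id.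
apply: eq_subst => i; case: (split_ordP i) => j ->.
  by rewrite vcatl sconj_zbar.
by rewrite vcatr sconj_zvar.
Qed.

Lemma sconj_holo f : sconj (holo f) = aholo f. Proof. by []. Qed.
Lemma sconj_aholo f : sconj (aholo f) = holo f.
Proof. by rewrite /aholo sconjK. Qed.

Lemma holoD : {morph @holo d : f g / f + g}.
Proof. by move=> f g; rewrite /holo substD. Qed.
Lemma holoB : {morph @holo d : f g / f - g}.
Proof. by move=> f g; rewrite /holo substB. Qed.
Lemma holoM : {morph @holo d : f g / f * g}.
Proof. by move=> f g; rewrite /holo substM. Qed.
Lemma holoZ (c : C) f : holo (c *: f) = c *: holo f.
Proof. by rewrite /holo substZ. Qed.
Lemma holo0 : @holo d 0 = 0. Proof. by rewrite /holo subst0. Qed.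
Lemma holo1 : @holo d 1 = 1. Proof. by rewrite /holo subst1. Qed.
Lemma holo_sum (I : Type) (r : seq I) (P : pred I) (F : I -> fps C d) :
  holo (\sum_(i <- r | P i) F i) = \sum_(i <- r | P i) holo (F i).
Proof. by rewrite /holo subst_sum. Qed.
Lemma aholoD : {morph @aholo d : f g / f + g}.
Proof. by move=> f g; rewrite /aholo holoD sconjD. Qed.
Lemma aholoM : {morph @aholo d : f g / f * g}.
Proof. by move=> f g; rewrite /aholo holoM sconjM. Qed.
Lemma aholoZ (c : C) f : aholo (c *: f) = c^* *: aholo f.
Proof. by rewrite /aholo holoZ sconjZ. Qed.
Lemma aholoB : {morph @aholo d : f g / f - g}.
Proof. by move=> f g; rewrite aholoD -!scaleN1r aholoZ rmorphN1. Qed.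
Lemma aholo1 : @aholo d 1 = 1.
Proof. by rewrite aholoE cmap1 subst1. Qed.
Lemma aholo_sum (I : Type) (r : seq I) (P : pred I) (F : I -> fps C d) :
  aholo (\sum_(i <- r | P i) F i) = \sum_(i <- r | P i) aholo (F i).
Proof. by rewrite /aholo holo_sum sconj_sum. Qed.

Lemma fcoef0_holo f : holo f 0%MM = f 0%MM.
Proof. by rewrite /holo fcoef0_subst. Qed.
Lemma fcoef0_aholo f : aholo f 0%MM = (f 0%MM)^*.
Proof. by rewrite aholoE fcoef0_subst. Qed.
Lemma vanish_holo k f : vanish_order k f -> vanish_order k (holo f).
Proof. by move=> v; apply: vanish_subst. Qed.
Lemma vanish_aholo k f : vanish_order k f -> vanish_order k (aholo f).
Proof.
move=> v; rewrite aholoE; apply: vanish_subst => // m mk.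
by rewrite /= v // rmorph0.
Qed.

Lemma prod_zvar (a : 'X_{1..d}) : \prod_i zvar i ^+ a i = fps_mon C (mcat a 0%MM).
Proof.
transitivity (\prod_i fps_mon C (U_(lshift d i) *+ a i)%MM).
  by apply: eq_bigr => i _; rewrite /zvar -fps_monU fps_monX.
rewrite fps_mon_prod; congr fps_mon; apply/mnmP => i; rewrite mnm_sumE.
case: (split_ordP i) => j ->; rewrite ?mcatl ?mcatr.
  rewrite (bigD1 j) //= big1 => [|k kj]; rewrite mulmnE mnm1E eq_lshift.
    by rewrite eqxx mul1n addn0.
  by rewrite (negbTE kj).
by rewrite mnm0E big1 // => k _; rewrite mulmnE mnm1E eq_lrshift.
Qed.

Lemma fcoef_holo f a b : holo f (mcat a b) = f a * (b == 0%MM)%:R.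
Proof.
have ha : (mdeg a < (mdeg (mcat a b)).+1)%N by rewrite mdeg_mcat ltnS leq_addr.
rewrite /holo /= (bigD1 (BMultinom ha)) //= [X in _ + X]big1 => [|k ne].
  by rewrite prod_zvar addr0 /= eq_mcat eqxx.
rewrite prod_zvar /= eq_mcat; case: eqP => [e|]; rewrite ?mulr0 //.
by case/eqP: ne; apply: val_inj.
Qed.

Lemma prod_zbar (a : 'X_{1..d}) : \prod_i zbar i ^+ a i = fps_mon C (mcat 0%MM a).
Proof.
transitivity (\prod_i fps_mon C (U_(rshift d i) *+ a i)%MM).
  by apply: eq_bigr => i _; rewrite /zbar -fps_monU fps_monX.
rewrite fps_mon_prod; congr fps_mon; apply/mnmP => i; rewrite mnm_sumE.
case: (split_ordP i) => j ->; rewrite ?mcatl ?mcatr; last first.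
  rewrite (bigD1 j) //= big1 => [|k kj]; rewrite mulmnE mnm1E eq_rshift.
    by rewrite eqxx mul1n addn0.
  by rewrite (negbTE kj).
by rewrite mnm0E big1 // => k _; rewrite mulmnE mnm1E eq_rlshift.
Qed.

Lemma fcoef_aholo f a b : aholo f (mcat a b) = (f b)^* * (a == 0%MM)%:R.
Proof.
have hb : (mdeg b < (mdeg (mcat a b)).+1)%N by rewrite mdeg_mcat ltnS leq_addl.
rewrite aholoE /= (bigD1 (BMultinom hb)) //= [X in _ + X]big1 => [|k ne].
  by rewrite prod_zbar addr0 /= eq_mcat eqxx andbT.
rewrite prod_zbar /= eq_mcat andbC; case: eqP => [e|]; rewrite ?mulr0 //.
by case/eqP: ne; apply: val_inj.
Qed.

Lemma prod_swap (a b : 'X_{1..d}) :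
  \prod_i vcat (@zbar d) (@zvar d) i ^+ mcat a b i = fps_mon C (mcat b a).
Proof.
rewrite big_split_ord /=.
under eq_bigr do rewrite vcatl mcatl.
under [X in _ * X]eq_bigr do rewrite vcatr mcatr.
by rewrite prod_zbar prod_zvar fps_monM mcatD add0m addm0.
Qed.

Lemma fcoef_sconj A a b : sconj A (mcat a b) = (A (mcat b a))^*.
Proof.
have ha : (mdeg (mcat b a) < (mdeg (mcat a b)).+1)%N.
  by rewrite !mdeg_mcat addnC.
rewrite /sconj /= (bigD1 (BMultinom ha)) //= [X in _ + X]big1 => [|k ne].
  by rewrite prod_swap /= eqxx mulr1 addr0.
have [a1 [b1 e1]] := mcatP k; rewrite e1 prod_swap /= eq_mcat.
case: andP => [[/eqP ea /eqP eb]|]; rewrite ?mulr0 //.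
by case/eqP: ne; apply: val_inj; rewrite /= e1 ea eb.
Qed.

(** The variables separate, so that the coefficients of f(Z) conj(g(Z)) form a
    matrix of rank one. Ranks and signatures are read off from the coefficient
    matrix through this formula. *)
Lemma fcoef_holo_aholo f g a b : (holo f * aholo g) (mcat a b) = f a * (g b)^*.
Proof.
set m := mcat a b.
have ha : (mdeg (mcat a (0%MM : 'X_{1..d})) < (mdeg m).+1)%N.
  by rewrite !mdeg_mcat mdeg0 addn0 ltnS leq_addr.
have hb : (mdeg (mcat (0%MM : 'X_{1..d}) b) < (mdeg m).+1)%N.
  by rewrite !mdeg_mcat mdeg0 ltnS leq_addl.
rewrite fcoefM (bigD1 (BMultinom ha, BMultinom hb)); last first.
  by rewrite /= mcatD addm0 add0m.
rewrite fcoef_holo fcoef_aholo !eqxx !mulr1 big1; first exact: addr0.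
move=> [k1 k2].
have [a1 [b1 e1]] := mcatP k1; have [a2 [b2 e2]] := mcatP k2.
rewrite [bmnm _]e1 [bmnm (k1, k2).2]e2 mcatD eq_mcat fcoef_holo fcoef_aholo.
move=> /andP[/andP[/eqP ea /eqP eb] ne].
have [b10|] := eqVneq b1; last by rewrite mulr0 mul0r.
have [a20|] := eqVneq a2; last by rewrite !mulr0.
case/eqP: ne; congr pair; apply: val_inj => /=.
  by rewrite e1 b10 ea a20 addm0.
by rewrite e2 a20 eb b10 add0m.
Qed.

Lemma prod_var0 (a b : 'X_{1..d}) :
  \prod_i vcat (@fps_var C d) (fun _ : 'I_d => 0) i ^+ mcat a b i =
    (b == 0%MM)%:R *: fps_mon C a.
Proof.
rewrite big_split_ord /=.
under eq_bigr do rewrite vcatl mcatl.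
under [X in _ * X]eq_bigr do rewrite vcatr mcatr.
rewrite prod_varE; have [->|/eqP b0] := eqVneq.
  by rewrite big1 ?mulr1 ?scale1r // => i _; rewrite mnm0E expr0.
have [i bi|h] := pickP (fun i => b i != 0%N).
  by rewrite scale0r (bigD1 i) //= expr0n (negbTE bi) mul0r mulr0.
by case: b0; apply/mnmP => i; rewrite mnm0E; apply/eqP/negbFE/h.
Qed.

(** The derivatives spanning V_A are the columns of the coefficient matrix of A,
    up to a factorial. *)
Lemma fcoef_bar_deriv A (b : 'X_{1..d}) : exists2 c : nat, (0 < c)%N &
  forall a, bar_deriv A b a = A (mcat a b) *+ c.
Proof.
exists (\prod_i (b i)`!)%N => [|a]; first by apply: prodn_gt0 => i; apply: fact_gt0.
have ha : (mdeg (mcat a (0%MM : 'X_{1..d})) < (mdeg a).+1)%N.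
  by rewrite mdeg_mcat mdeg0 addn0.
rewrite /bar_deriv /= (bigD1 (BMultinom ha)) //= [X in _ + X]big1 => [|k].
  rewrite prod_var0 eqxx scale1r addr0 /= eqxx mulr1 mcatD addm0 add0m.
  congr (_ *+ _); rewrite big_split_ord /= big1 ?mul1n => [|i _].
    by apply: eq_bigr => i _; rewrite !mcatr ffactnn.
  by rewrite !mcatl mnm0E ffactn0.
have [a1 [b1 e1]] := mcatP k; rewrite e1 prod_var0 /= => ne.
have [b10|] := eqVneq b1; last by rewrite mul0r mulr0.
case: eqP => [e|]; rewrite ?mulr0 //.
by case/eqP: ne; apply: val_inj; rewrite /= e1 b10 e.
Qed.

End Hol.
#[local] Hint Resolve nocst_swap nocst_zvar nocst_zbar : core.

Section Pullback.

Lemma nocst_holo e d (H : 'I_e -> fps C d) : nocst H -> nocst (fun i => holo (H i)).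
Proof. by move=> H0 i; rewrite fcoef0_holo. Qed.
Lemma nocst_aholo e d (H : 'I_e -> fps C d) : nocst H -> nocst (fun i => aholo (H i)).
Proof. by move=> H0 i; rewrite fcoef0_aholo H0 rmorph0. Qed.

Lemma nocst_pull e d (H : 'I_e -> fps C d) : nocst H ->
  nocst (vcat (fun i => holo (H i)) (fun i => aholo (H i))).
Proof. by move=> H0; apply: nocst_vcat; [apply: nocst_holo|apply: nocst_aholo]. Qed.
Hint Resolve nocst_pull : core.

Variables (d e : nat) (H : 'I_e -> fps C d).
Hypothesis H0 : nocst H.
Implicit Types A B : fps C (e + e).

Lemma pullB A B : pull (A - B) H = pull A H - pull B H.
Proof. exact: substB. Qed.
Lemma pullM A B : pull (A * B) H = pull A H * pull B H.
Proof. by rewrite /pull substM; auto. Qed.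
Lemma pullZ (c : C) A : pull (c *: A) H = c *: pull A H.
Proof. exact: substZ. Qed.
Lemma pull_sum (I : Type) (r : seq I) (P : pred I) (F : I -> fps C (e + e)) :
  pull (\sum_(i <- r | P i) F i) H = \sum_(i <- r | P i) pull (F i) H.
Proof. exact: subst_sum. Qed.
Lemma fcoef0_pull A : pull A H 0%MM = A 0%MM.
Proof. by rewrite /pull fcoef0_subst; auto. Qed.

Lemma pull_holo (f : fps C e) : pull (holo f) H = holo (fps_subst f H).
Proof.
rewrite /pull /holo !subst_assoc; try exact: nocst_pull; try by [].
apply: eq_subst => i.
by rewrite subst_var ?vcatl //; apply: nocst_pull.
Qed.
Lemma pull_aholo (f : fps C e) : pull (aholo f) H = aholo (fps_subst f H).
Proof.
rewrite /pull !aholoE cmap_subst !subst_assoc; auto; last exact: nocst_cmap.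
by apply: eq_subst => i; rewrite subst_var ?vcatr ?aholoE //; apply: nocst_pull.
Qed.

Lemma pull_comp c (K : 'I_c -> fps C e) (A : fps C (c + c)) : nocst K ->
  pull (pull A K) H = pull A (fun i => fps_subst (K i) H).
Proof.
move=> K0; rewrite {1 2}/pull subst_assoc; auto; apply: eq_subst => i.
by case: (split_ordP i) => j ->; rewrite ?vcatl ?vcatr;
  [apply: pull_holo|apply: pull_aholo].
Qed.

End Pullback.
End Conj.

(** * Hermitian forms and inertia *)

Local Open Scope sesquilinear_scope.

Section LinearAlgebra.
Variable C : numClosedFieldType.

(** The number of negative squares of a diagonal form. *)
Definition negs k (D : 'I_k -> C) : nat := (\sum_j (D j < 0)%R)%N.

Lemma negs_card k (D : 'I_k -> C) : negs D = #|[pred j | D j < 0]|.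
Proof.
rewrite /negs -sum1_card [RHS]big_mkcond; apply: eq_bigr => j _.
by rewrite inE; case: (_ < _).
Qed.

(** Law of inertia. If D had more negative entries than E, some nonzero vector
    supported on the negative entries of D would be sent by Y into the
    coordinates where E is nonnegative; its square would be negative for D and
    nonnegative for E. *)
Lemma inertia_le r k (Y : 'M[C]_(r, k)) (D : 'I_r -> C) (E : 'I_k -> C) :
  (forall j, E j \is Num.real) ->
  (forall v : 'rV_r, \sum_j D j * (v 0 j * (v 0 j)^*) =
     \sum_j E j * ((v *m Y) 0 j * ((v *m Y) 0 j)^*)) ->
  (negs D <= negs E)%N.
Proof.
move=> Er DE; rewrite !negs_card leqNgt; apply/negP => lt.
(* u ranges over the vectors supported on the negative entries of D, and
   vanishes on the negative coordinates of E: these are fewer conditions than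
   unknowns. *)
pose nD := [pred j | D j < 0]; pose nE := [pred j | E j < 0].
pose Z : 'M[C]_(#|nD|, r) := \matrix_(i, j) (enum_val i == j)%:R.
pose W : 'M[C]_(k, #|nE|) := \matrix_(i, j) (i == enum_val j)%:R.
have [u u0 uM] : exists2 u : 'rV_#|nD|, u != 0 & u *m (Z *m Y *m W) = 0.
  have : kermx (Z *m Y *m W) != 0.
    rewrite kermx_eq0 /row_free neq_ltn; apply/orP; left.
    by apply: leq_ltn_trans lt; apply: rank_leq_col.
  case/rowV0Pn => u uk u0; exists u => //; exact/sub_kermxP.
pose v := u *m Z.
have vE i : v 0 (enum_val i) = u 0 i.
  rewrite mxE (bigD1 i) //= mxE eqxx mulr1 big1 ?addr0 // => j ji.
  by rewrite mxE (inj_eq enum_val_inj) (negbTE ji) mulr0.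
have v0 j : ~~ nD j -> v 0 j = 0.
  move=> nj; rewrite mxE big1 // => i _; rewrite mxE; case: eqP => [e|]; last by rewrite mulr0.
  by case/negP: nj; rewrite -e; have := enum_valP i.
have vY j : nE j -> (v *m Y) 0 j = 0.
  move=> jE; have /(congr1 (fun x : 'rV_#|nE| => x 0 (enum_rank_in jE j))) := uM.
  rewrite !mulmxA -/v mxE [RHS]mxE (bigD1 j) //= big1 ?addr0.
    by rewrite [W _ _]mxE enum_rankK_in // eqxx mulr1.
  by move=> i ij; rewrite [W _ _]mxE enum_rankK_in // (negbTE ij) mulr0.
have lt0 : \sum_j D j * (v 0 j * (v 0 j)^*) < 0.
  have /existsP[i ui] : [exists i, u 0 i != 0].
    by move/rV0Pn: u0 => [i ui]; apply/existsP; exists i.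
  rewrite (bigD1 (enum_val i)) //= -[ltRHS]addr0; apply: ltr_leD.
    have Di : D (enum_val i) < 0 by have := enum_valP i.
    by rewrite nmulr_rlt0 // vE mul_conjC_gt0.
  apply: sumr_le0 => j _; have [jD|jD] := boolP (nD j); last first.
    by rewrite v0 // mul0r mulr0.
  by rewrite nmulr_rle0 // mul_conjC_ge0.
suff : 0 <= \sum_j D j * (v 0 j * (v 0 j)^*) by rewrite (lt_geF lt0).
rewrite DE; apply: sumr_ge0 => j _; have [jE|jE] := boolP (nE j).
  by rewrite vY // mul0r mulr0.
by apply: mulr_ge0; rewrite ?mul_conjC_ge0 // real_leNgt ?real0.
Qed.

Lemma hermitian_diag r (K : 'M[C]_r) : K^t* = K ->
  exists Q (d : 'rV[C]_r),
    [/\ Q \in unitmx, forall j, d 0 j \is Num.real & K = Q *m diag_mx d *m Q^t*].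
Proof.
move=> Kh; have Kherm : K \is hermsymmx.
  by apply/is_hermitianmxP; rewrite expr0 scale1r Kh.
have /orthomx_spectralP e := hermitian_normalmx Kherm.
exists (invmx (spectralmx K)), (spectral_diag K); split.
- by rewrite unitmx_inv spectral_unit.
- by move=> j; move/mxOverP: (hermitian_spectral_diag_real Kherm); apply.
- by rewrite {1}e invmx_unitary ?spectral_unitarymx // trmxCK.
Qed.

Lemma adjM m n p (A : 'M[C]_(m, n)) (B : 'M_(n, p)) : (A *m B)^t* = B^t* *m A^t*.
Proof. by rewrite trmx_mul map_mxM. Qed.
Lemma adjD m n (A B : 'M[C]_(m, n)) : (A + B)^t* = A^t* + B^t*.
Proof. by rewrite linearD /= map_mxD. Qed.
Lemma adj_diag n (d : 'rV[C]_n) : (forall j, d 0 j \is Num.real) ->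
  (diag_mx d)^t* = diag_mx d.
Proof.
move=> dr; rewrite tr_diag_mx map_diag_mx; congr diag_mx; apply/rowP => j.
by rewrite mxE; apply/CrealP.
Qed.

Lemma sesqui_diagE n (d u v : 'rV[C]_n) :
  (u *m diag_mx d *m v^t*) 0 0 = \sum_j d 0 j * (u 0 j * (v 0 j)^*).
Proof.
rewrite mxE; apply: eq_bigr => j _.
by rewrite mul_mx_diag !mxE mulrA [u 0 j * _]mulrC.
Qed.

Lemma inertia_mx r k (Y : 'M[C]_(r, k)) (D : 'rV[C]_r) (E : 'rV[C]_k) :
  (forall j, E 0 j \is Num.real) ->
  Y *m diag_mx E *m Y^t* = diag_mx D ->
  (negs (fun j => D 0%R j) <= negs (fun j => E 0%R j))%N.
Proof.
move=> Er YE; apply: (@inertia_le r k Y) => // v.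
by rewrite -!sesqui_diagE -YE adjM !mulmxA.
Qed.

Lemma negs_row_mx m n (D1 : 'rV[C]_m) (D2 : 'rV[C]_n) :
  negs (fun j => row_mx D1 D2 0 j) =
    (negs (fun j => D1 0%R j) + negs (fun j => D2 0%R j))%N.
Proof.
rewrite /negs big_split_ord /=; congr (_ + _)%N; apply: eq_bigr => i _.
  by rewrite row_mxEl.
by rewrite row_mxEr.
Qed.

(** The rows of L span a subspace on which E' restricts to the nondegenerate
    form a E, so that E' is the orthogonal sum of a E and of a form on the
    orthogonal of the rows of L, diagonalized with entries d. The coordinates of
    a row u are then u X and u Y. *)
Lemma form_splitting N n (E' : 'rV[C]_N) (E : 'rV[C]_n) (a : C) (L : 'M[C]_(n, N)) :
  (forall j, E' 0 j \is Num.real) -> (forall j, E 0 j \is Num.real) ->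
  (forall j, E 0 j * E 0 j = 1) ->
  a \is Num.real -> a != 0 ->
  L *m diag_mx E' *m L^t* = a *: diag_mx E ->
  exists k (X : 'M[C]_(N, n)) (Y : 'M[C]_(N, k)) (d : 'rV[C]_k),
  [/\ (k <= N - n)%N, L *m X = 1%:M, L *m Y = 0, forall j, d 0 j \is Num.real &
    [/\ diag_mx E' = X *m (a *: diag_mx E) *m X^t* + Y *m diag_mx d *m Y^t*,
      (negs (fun j => (a *: E) 0%R j) + negs (fun j => d 0%R j) <=
         negs (fun j => E' 0%R j))%N &
      (negs (fun j => (- (a *: E)) 0%R j) + negs (fun j => (- d) 0%R j) <=
         negs (fun j => (- E') 0%R j))%N]].
Proof.
move=> E'r Er E2 ar a0 Levi.
have EE : diag_mx E *m diag_mx E = 1%:M.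
  apply/matrixP => i j; rewrite mul_diag_mx !mxE.
  by case: eqP => [->|]; rewrite ?mulr1n ?E2 // !mulr0n mulr0.
have E'h := adj_diag E'r; have Eh := adj_diag Er.
have [X LX XL0] : exists2 X : 'M[C]_(N, n), L *m X = 1%:M &
    (1%:M - X *m L) *m (diag_mx E' *m L^t*) = 0.
  (* u |-> u *m X *m L is the orthogonal projection on the rows of L. *)
  exists (a^-1 *: (diag_mx E' *m L^t* *m diag_mx E)).
    by rewrite -scalemxAr !mulmxA Levi -scalemxAl EE scalerA mulVf // scale1r.
  rewrite mulmxBl mul1mx -!mulmxA -scalemxAl -!mulmxA [L *m (_ *m _)]mulmxA Levi.
  by rewrite -!scalemxAr EE mulmx1 scalerA mulVf // scale1r subrr.
have [k [C0 [Y0 [kle C0L Y0C0 LY0]]]] : exists k (C0 : 'M[C]_(k, N)) Y0,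
    [/\ (k <= N - n)%N, C0 *m (diag_mx E' *m L^t*) = 0,
        Y0 *m C0 = 1%:M - X *m L & L *m Y0 = 0].
  (* The rows of C0 form a basis of the orthogonal of the rows of L. *)
  exists _, (row_base (kermx (diag_mx E' *m L^t*))).
  exists ((1%:M - X *m L) *m pinvmx (row_base (kermx (diag_mx E' *m L^t*)))).
  split.
  - rewrite mxrank_ker leq_sub2l //.
    have : \rank (L *m diag_mx E' *m L^t*) = n.
      rewrite Levi mxrank_scale_nz //; apply/mxrank_unit.
      by have [] := mulmx1_unit EE.
    by rewrite -mulmxA => {1}<-; apply: mxrankM_maxr.
  - by apply/sub_kermxP; rewrite eq_row_base.
  - by rewrite mulmxKpV // eq_row_base; apply/sub_kermxP.
  - have LXL : L *m (1%:M - X *m L) = 0.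
      by rewrite mulmxBr mulmx1 [L *m _]mulmxA LX mul1mx subrr.
    by rewrite [LHS]mulmxA LXL mul0mx.
pose K := C0 *m diag_mx E' *m C0^t*.
have [|Q [d [Qu dr KQ]]] := @hermitian_diag _ K.
  by rewrite /K !adjM trmxCK E'h mulmxA.
pose C1 := invmx Q *m C0; pose Y := Y0 *m Q.
have Qadj : Q^t* *m (invmx Q)^t* = 1%:M.
  by rewrite -adjM mulVmx // trmx1 map_mx1.
have C1C1 : C1 *m diag_mx E' *m C1^t* = diag_mx d.
  rewrite /C1 adjM !mulmxA -[_ *m C0 *m _ *m _]mulmxA -!mulmxA.
  rewrite [C0 *m _]mulmxA [_ *m (_ *m (invmx Q)^t*)]mulmxA -/K KQ.
  by rewrite -!mulmxA Qadj mulmx1 mulmxA mulVmx // mul1mx.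
have C1L : C1 *m diag_mx E' *m L^t* = 0.
  by rewrite /C1 -!mulmxA C0L mulmx0.
have LC1 : L *m diag_mx E' *m C1^t* = 0.
  have /(congr1 (fun M => M^t*)) := C1L; rewrite !adjM trmxCK E'h => e.
  by rewrite -mulmxA e trmx0 map_mx0.
have one : X *m L + Y *m C1 = 1%:M.
  by rewrite /Y /C1 -mulmxA mulKVmx // Y0C0 addrC subrK.
have LY : L *m Y = 0 by rewrite [LHS]mulmxA LY0 mul0mx.
clearbody C1 Y.
have signs := @inertia_mx _ _ (col_mx L C1).
(* The rows of L and C1 form an orthogonal basis for E', so that the two
   diagonal forms can be compared by inertia. *)
have colE : col_mx L C1 *m diag_mx E' *m (col_mx L C1)^t* =
    diag_mx (row_mx (a *: E) d).
  rewrite tr_col_mx map_row_mx mul_col_mx mul_col_row.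
  rewrite diag_mx_row C1C1 C1L LC1 Levi linearZ //=.
exists k, X, Y, d; split=> //.
- split.
  + transitivity
      ((X *m L + Y *m C1) *m diag_mx E' *m (X *m L + Y *m C1)^t*).
      by rewrite one trmx1 map_mx1 mul1mx mulmx1.
    rewrite adjD !adjM !mulmxDl !mulmxDr -!mulmxA.
    have LL m (M : 'M_(n, m)) :
        L *m (diag_mx E' *m (L^t* *m M)) = a *: diag_mx E *m M.
      by rewrite !mulmxA Levi.
    have LC m (M : 'M_(k, m)) : L *m (diag_mx E' *m (C1^t* *m M)) = 0.
      by rewrite !mulmxA LC1 mul0mx.
    have CL m (M : 'M_(n, m)) : C1 *m (diag_mx E' *m (L^t* *m M)) = 0.
      by rewrite !mulmxA C1L mul0mx.
    have CC m (M : 'M_(k, m)) :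
        C1 *m (diag_mx E' *m (C1^t* *m M)) = diag_mx d *m M.
      by rewrite !mulmxA C1C1.
    by rewrite LL LC CL CC !mulmx0 addr0 add0r.
  + by rewrite -negs_row_mx; apply: signs.
  + rewrite -negs_row_mx -opp_row_mx; apply: signs => [j|].
      by rewrite mxE rpredN.
    by rewrite !linearN /= mulNmx colE.
Qed.
End LinearAlgebra.

(** * Spans and dimensions *)

Local Open Scope classical_set_scope.
Local Open Scope ring_scope.

Section Spans.
Variables (K : fieldType) (V : lmodType K).
Implicit Types (S W : set V).

Lemma lspan_range r (b : 'I_r -> V) v :
  lspan (range b) v <-> exists c : 'rV[K]_r, v = \sum_j c 0 j *: b j.
Proof.
split=> [[k [c [u [uS ->]]]]|[c ->]]; last first.
  by exists r, (fun j => c 0 j), b; split=> // j; exists j.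
have /choice[s sE] : forall j, exists i, b i = u j.
  by move=> j; have [i _ e] := uS j; exists i.
exists (\row_i \sum_(j | s j == i) c j).
rewrite (partition_big s xpredT) //=; apply: eq_bigr => i _.
rewrite mxE scaler_suml; apply: eq_bigr => j /eqP <-.
by rewrite sE.
Qed.

Lemma sub_lspan S v : S v -> lspan S v.
Proof.
move=> Sv; exists 1%N, (fun=> 1), (fun=> v); split=> //.
by rewrite big_ord_recl big_ord0 addr0 scale1r.
Qed.

Lemma lspan_sub S r (b : 'I_r -> V) :
  (forall v, S v -> lspan (range b) v) -> forall v, lspan S v -> lspan (range b) v.
Proof.
move=> Sb v [k [c [u [uS ->]]]].
have /choice[x xE] : forall j, exists x : 'rV[K]_r, u j = \sum_i x 0 i *: b i.
  by move=> j; apply/lspan_range/Sb.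
apply/lspan_range; exists (\row_i \sum_j c j * x j 0 i).
under eq_bigr do rewrite xE scaler_sumr.
rewrite exchange_big /=; apply: eq_bigr => i _.
by rewrite mxE scaler_suml; apply: eq_bigr => j _; rewrite scalerA.
Qed.

Lemma in_span_mx r k (b : 'I_r -> V) (phi : 'I_k -> V) :
  (forall j, lspan (range phi) (b j)) ->
  exists M : 'M[K]_(r, k), forall j, b j = \sum_i M j i *: phi i.
Proof.
move=> h; have /choice[x xE] : forall j, exists x : 'rV[K]_k,
    b j = \sum_i x 0 i *: phi i by move=> j; apply/lspan_range.
by exists (\matrix_j x j) => j; rewrite xE; apply: eq_bigr => i _; rewrite mxE.
Qed.

Lemma comb_mx r k (b : 'I_r -> V) (phi : 'I_k -> V) (M : 'M[K]_(r, k)) (u : 'rV_r) :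
  (forall j, b j = \sum_i M j i *: phi i) ->
  \sum_j u 0 j *: b j = \sum_i (u *m M) 0 i *: phi i.
Proof.
move=> bE; under eq_bigr do rewrite bE scaler_sumr.
rewrite exchange_big /=; apply: eq_bigr => i _.
by rewrite mxE scaler_suml; apply: eq_bigr => j _; rewrite scalerA.
Qed.

Lemma lin_indep_row_free r k (b : 'I_r -> V) (phi : 'I_k -> V) (M : 'M[K]_(r, k)) :
  lin_indep b -> (forall j, b j = \sum_i M j i *: phi i) -> row_free M.
Proof.
move=> bi bE; rewrite -kermx_eq0; apply/rowV0P => u /sub_kermxP uM.
apply/rowP => j; rewrite [RHS]mxE; apply: (bi (fun j => u 0 j)).
by rewrite (comb_mx _ bE) uM big1 // => i _; rewrite mxE scale0r.
Qed.

Lemma lin_indep_leq r k (b : 'I_r -> V) (phi : 'I_k -> V) :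
  lin_indep b -> (forall j, lspan (range phi) (b j)) -> (r <= k)%N.
Proof.
move=> bi /in_span_mx[M bE].
by rewrite -(eqP (lin_indep_row_free bi bE)) rank_leq_col.
Qed.

Lemma lin_indep_in_span r (b phi : 'I_r -> V) :
  lin_indep b -> (forall j, lspan (range phi) (b j)) ->
  forall j, lspan (range b) (phi j).
Proof.
move=> bi /in_span_mx[M bE] j; apply/lspan_range.
have Mu : M \in unitmx by rewrite -row_free_unit (lin_indep_row_free bi bE).
exists (row j (invmx M)); rewrite (comb_mx _ bE) -row_mul mulVmx //.
rewrite (bigD1 j) //= !mxE eqxx scale1r big1 ?addr0 // => i ij.
by rewrite !mxE eq_sym (negbTE ij) scale0r.
Qed.

(** A linearly independent family of maximal size in S spans the same space
    as S. *)
Lemma has_dim_leq S k (phi : 'I_k -> V) :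
  (forall v, S v -> lspan (range phi) v) ->
  exists2 r, (r <= k)%N & has_dim (lspan S) r.
Proof.
move=> Sphi.
pose P r := `[< exists b : 'I_r -> V, lin_indep b /\ forall j, S (b j) >].
have P0 : P 0%N.
  apply/asboolP; exists (fun i : 'I_0 => 0); split=> [c _ []|[]] //.
have Pk r : P r -> (r <= k)%N.
  by move=> /asboolP[b [bi bS]]; apply: (lin_indep_leq bi) => j; apply: Sphi.
have exP : exists r, P r by exists 0%N.
case: (ex_maxnP exP Pk) => r /asboolP[b [bi bS]] rmax.
exists r; first by apply: Pk; apply/asboolP; exists b.
exists b; split=> //; apply/seteqP; split=> v.
  move=> [m [c [u [uS ->]]]]; exists m, c, u; split=> // j.
  by have [i _ <-] := uS j.
apply: lspan_sub => {}v vS.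
have [//|nv] := pselect (lspan (range b) v).
suff /rmax : P (r + 1)%N by rewrite addn1 ltnn.
apply/asboolP; exists (vcat b (fun=> v)); split; last first.
  by move=> j; rewrite /vcat; case: split.
move=> c; rewrite big_split_ord /=.
under eq_bigr do rewrite /vcat (unsplitK (inl _)).
rewrite big_ord_recl big_ord0 addr0 /vcat (unsplitK (inr _)).
set x := c _ => e.
have x0 : x = 0.
  apply/eqP/negPn/negP => xn0; apply: nv; apply/lspan_range.
  exists (\row_i (- x^-1 * c (lshift 1 i))).
  apply: (scalerI xn0); rewrite scaler_sumr.
  move/eqP: e; rewrite addrC addr_eq0 => /eqP ->.
  rewrite -sumrN; apply: eq_bigr => i _.
  by rewrite mxE scalerA mulrA mulrN mulfV // mulN1r scaleNr.
move: e; rewrite x0 scale0r addr0 => /bi c0 j.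
by case: (split_ordP j) => i ->; rewrite ?c0 // (ord1 i).
Qed.
End Spans.

Section Minors.
Variables (K : fieldType) (d : nat).

(** Linear independence of finitely many series is already visible on finitely
    many coefficients. *)
Lemma lin_indep_minor r (phi : 'I_r -> fps K d) : lin_indep phi ->
  exists alpha : 'I_r -> 'X_{1..d}, (\matrix_(i, j) phi j (alpha i)) \in unitmx.
Proof.
move=> phii.
suff: forall t, (t <= r)%N -> exists alpha : 'I_t -> 'X_{1..d},
    row_free (\matrix_(i, j) phi j (alpha i)).
  by move=> /(_ r (leqnn r))[alpha h]; exists alpha; rewrite -row_free_unit.
elim=> [_|t IHt tr]; first by exists (fun=> 0%MM); rewrite /row_free -leqn0 rank_leq_row.
have [alpha] := IHt (ltnW tr); set M := \matrix_(i, j) _ => Mfree.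
(* As long as t < r, some nontrivial combination of the phi j vanishes at all
   the exponents chosen so far; one of its nonzero coefficients sits at an
   exponent that increases the rank. *)
have [c c0 Mc] : exists2 c : 'rV_r, c != 0 & M *m c^T = 0.
  have : kermx M^T != 0.
    rewrite kermx_eq0 /row_free mxrank_tr neq_ltn; apply/orP; left.
    by apply: leq_ltn_trans tr; apply: rank_leq_row.
  case/rowV0Pn => u uk u0; exists u => //; apply: trmx_inj.
  by rewrite trmx_mul trmxK trmx0; apply/sub_kermxP.
have [a0 ha0] : exists a0, (\sum_j c 0 j *: phi j) a0 != 0.
  apply: contrapT => /forallNP h; case/negP: c0; apply/eqP/rowP => j.
  rewrite mxE; apply: (phii (fun j => c 0 j)); apply: fpsP => a.
  by apply/eqP/negPn/negP; apply: h.
rewrite -addn1; exists (vcat alpha (fun=> a0)).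
set M' := \matrix_(i, j) _.
have -> : M' = col_mx M (\row_j phi j a0).
  apply/matrixP => i j; case: (split_ordP i) => i' ->.
    by rewrite col_mxEu !mxE /vcat (unsplitK (inl _)).
  by rewrite col_mxEd !mxE /vcat (unsplitK (inr _)).
rewrite -kermx_eq0; apply/rowV0P => u /sub_kermxP.
rewrite -[u]hsubmxK mul_row_col; set u1 := lsubmx u; set u2 := rsubmx u => uM.
have u20 : u2 = 0.
  have := congr1 (fun w : 'rV_r => (w *m c^T) 0 0) uM.
  rewrite mulmxDl -mulmxA Mc mulmx0 add0r mul0mx [RHS]mxE -mulmxA mxE big_ord1.
  move/eqP; rewrite mulf_eq0 => /orP[/eqP e|].
    by apply/rowP => j; rewrite (ord1 j) e mxE.
  rewrite mxE; under eq_bigr do rewrite !mxE mulrC.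
  rewrite (_ : \sum_i _ = (\sum_j c 0 j *: phi j) a0).
    by rewrite (negbTE ha0).
  by rewrite fcoef_sum.
move: uM; rewrite u20 mul0mx addr0 => uM.
have -> : u1 = 0; last by rewrite row_mx0.
by apply: (row_free_inj Mfree); rewrite uM mul0mx.
Qed.
End Minors.

(** * Sums of squares: rank and signature *)

(** In [herm] the negative squares come first; this reorders a sum of signed
    squares accordingly. *)
Lemma sort_pred (T : finType) m (b : pred T) : #|T| = m ->
  exists2 s : 'I_m -> T, bijective s & forall j : 'I_m, b (s j) = (j < #|b|)%N.
Proof.
move=> cT; pose l := filter b (enum T) ++ filter (predC b) (enum T).
have sl : size l == m.
  by rewrite size_cat !size_filter count_predC -cardT cT.
have ul : uniq l.
  have hasF : ~~ has (mem (filter b (enum T))) (filter (predC b) (enum T)).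
    by apply/hasPn => x; rewrite /= !mem_filter /= => /andP[/negbTE -> _].
  by rewrite cat_uniq hasF !(filter_uniq _ (enum_uniq T)).
have sb : size (filter b (enum T)) = #|b|.
  by rewrite size_filter -sum1_count big_enum_cond -sum1_card.
pose t : m.-tuple T := Tuple sl.
exists (tnth t).
  by apply: inj_card_bij; [apply/tuple_uniqP|rewrite cT card_ord].
move=> j; rewrite (tnth_nth (tnth t j)) /= nth_cat sb.
case: ltnP => jb.
  have : nth (tnth t j) (filter b (enum T)) j \in filter b (enum T).
    by rewrite mem_nth // sb.
  by rewrite mem_filter => /andP[].
have : nth (tnth t j) (filter (predC b) (enum T)) (j - #|b|)
    \in filter (predC b) (enum T).
  rewrite mem_nth // -sb ltn_subLR ?sb // -sb -size_cat (eqP sl) //.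
by rewrite mem_filter => /andP[/negbTE].
Qed.

Section Signature.
Variables (C : numClosedFieldType) (d : nat).
Implicit Types (A B : fps C (d + d)).

Definition sum_squares k (D : 'rV[C]_k) (phi : 'I_k -> fps C d) : fps C (d + d) :=
  \sum_j D 0 j *: (holo (phi j) * aholo (phi j)).

Lemma fcoef_sum_squares k (D : 'rV[C]_k) (phi : 'I_k -> fps C d) a b :
  sum_squares D phi (mcat a b) = \sum_j D 0 j * (phi j a * (phi j b)^*).
Proof.
rewrite fcoef_sum; apply: eq_bigr => j _.
by rewrite fcoefZ fcoef_holo_aholo.
Qed.

Lemma fps_mcatP A B : (forall a b, A (mcat a b) = B (mcat a b)) -> A = B.
Proof. by move=> e; apply: fpsP => m; have [a [b ->]] := mcatP m. Qed.

Lemma bar_deriv_sum_squares k (D : 'rV[C]_k) (phi : 'I_k -> fps C d) b :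
  exists2 c : C, c != 0 & bar_deriv (sum_squares D phi) b =
    \sum_j (c * D 0 j * (phi j b)^*) *: phi j.
Proof.
have [c c0 cE] := fcoef_bar_deriv (sum_squares D phi) b.
exists c%:R; first by rewrite pnatr_eq0 -lt0n.
apply: fpsP => a; rewrite cE fcoef_sum_squares fcoef_sum -[LHS]mulr_natl big_distrr.
by apply: eq_bigr => j _; rewrite fcoefZ -!mulrA [phi j a * _]mulrC.
Qed.

Lemma bar_deriv_span k (D : 'rV[C]_k) (phi : 'I_k -> fps C d) f :
  lspan (range (bar_deriv (sum_squares D phi))) f -> lspan (range phi) f.
Proof.
apply: lspan_sub => _ [b _ <-]; have [c _ ->] := bar_deriv_sum_squares D phi b.
by apply/lspan_range; exists (\row_j (c * D 0 j * (phi j b)^*));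
  apply: eq_bigr => j _; rewrite mxE.
Qed.

Lemma sum_squares_rank k (D : 'rV[C]_k) (phi : 'I_k -> fps C d) :
  exists2 r, (r <= k)%N &
    has_dim (lspan (range (bar_deriv (sum_squares D phi)))) r.
Proof.
apply: (has_dim_leq (phi := phi)) => f Sf; apply: bar_deriv_span.
exact: sub_lspan Sf.
Qed.

(** Evaluated on a minor where chi is a basis, the identity becomes one between
    diagonal forms, to which the law of inertia applies. *)
Lemma sum_squares_inertia r k (D : 'rV[C]_r) (chi : 'I_r -> fps C d)
    (E : 'rV[C]_k) (phi : 'I_k -> fps C d) :
  lin_indep chi -> (forall j, E 0 j \is Num.real) ->
  sum_squares D chi = sum_squares E phi ->
  (negs (fun j => D 0%R j) <= negs (fun j => E 0%R j))%N.
Proof.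
move=> chii Er e; have [alpha] := lin_indep_minor chii.
set M := \matrix_(i, j) _ => Mu; pose P := \matrix_(i, j) phi j (alpha i).
have MP : M *m diag_mx D *m M^t* = P *m diag_mx E *m P^t*.
  apply/matrixP => i j.
  have := congr1 (fun x : fps C (d + d) => x (mcat (alpha i) (alpha j))) e.
  rewrite !fcoef_sum_squares => s; rewrite !mul_mx_diag !mxE.
  transitivity (\sum_l D 0 l * (chi l (alpha i) * (chi l (alpha j))^*)).
    by apply: eq_bigr => l _; rewrite !mxE mulrA [D 0 l * _]mulrC.
  by rewrite s; apply: eq_bigr => l _; rewrite !mxE mulrA [E 0 l * _]mulrC.
apply: (@inertia_mx _ _ _ (invmx M *m P)) => //.
rewrite adjM !mulmxA -[invmx M *m P *m _]mulmxA -[invmx M *m _ *m _]mulmxA -MP.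
rewrite -!mulmxA mulKmx // -adjM mulVmx // trmx1 map_mx1 mulmx1 //.
Qed.

Definition sgn_row r s : 'rV[C]_r := \row_j (-1) ^+ (j < s)%N.

Lemma sqrtC_sq (x : C) : 0 <= x -> sqrtC x * (sqrtC x)^* = x.
Proof.
by move=> x0; rewrite conj_Creal ?ger0_real ?sqrtC_ge0 // -expr2 sqrtCK.
Qed.

(** The absolute values of the D_j are absorbed in phi, and the negative signs
    are brought in front. *)
Lemma sum_squares_normalize r (D : 'rV[C]_r) (phi : 'I_r -> fps C d) :
  (forall j, D 0 j \is Num.real) -> (forall j, D 0 j != 0) -> lin_indep phi ->
  exists s psi, [/\ (s <= r)%N, lin_indep psi &
    sum_squares D phi = sum_squares (sgn_row r s) psi].
Proof.
move=> Dr D0 phii.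
have [sig [tau st ts] sigE] := @sort_pred 'I_r r (fun j => D 0 j < 0) (card_ord r).
pose c j := sqrtC `|D 0 j|.
have c0 j : c j != 0 by rewrite sqrtC_eq0 normr_eq0.
exists #|[pred j | D 0 j < 0]|, (fun j => c (sig j) *: phi (sig j)); split.
- by rewrite -[X in (_ <= X)%N]card_ord max_card.
- move=> x e j.
  have : \sum_i (x (tau i) * c i) *: phi i = 0.
    rewrite (reindex sig) /=; last by exists tau => i _; [apply: st|apply: ts].
    by rewrite -[RHS]e; apply: eq_bigr => i _; rewrite st scalerA.
  move/phii/(_ (sig j))/eqP; rewrite st mulf_eq0 (negbTE (c0 _)) orbF.
  by move/eqP.
- rewrite /sum_squares (reindex sig) /=; last by exists tau => i _; [apply: st|apply: ts].
  apply: eq_bigr => j _; rewrite mxE -sigE holoZ aholoZ -scalerAl -scalerAr !scalerA.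
  rewrite -mulrA sqrtC_sq ?normr_ge0 //; congr (_ *: _).
  exact: realEsign.
Qed.

(** In a basis b of V_A one has A = sum_ij K_ij b_i conj(b_j); hermitian
    symmetry of A passes to K because b is independent on a minor, and K is
    diagonalized. No eigenvalue is zero, as r is the dimension of V_A. *)
Lemma hermitian_sum_squares A r :
  (forall a b, A (mcat b a) = (A (mcat a b))^*) ->
  has_dim (lspan (range (bar_deriv A))) r ->
  exists s psi, [/\ (s <= r)%N, lin_indep psi & A = sum_squares (sgn_row r s) psi].
Proof.
move=> Ah [b [bi bA]].
have /choice[c cE] : forall beta, exists c : 'cV[C]_r,
    forall a, A (mcat a beta) = \sum_j b j a * c j 0.
  move=> beta; have [k k0 kE] := fcoef_bar_deriv A beta.
  have : lspan (range b) (bar_deriv A beta) by rewrite bA; apply: sub_lspan; exists beta.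
  move/lspan_range => [x xE]; exists ((k%:R)^-1 *: x^T) => a.
  have := kE a; rewrite xE fcoef_sum -[RHS]mulr_natl => e.
  have kn0 : k%:R != 0 :> C by rewrite pnatr_eq0 -lt0n.
  apply: (mulfI kn0); rewrite -e big_distrr; apply: eq_bigr => j _.
  by rewrite !mxE fcoefZ [RHS]mulrCA [X in b j a * X]mulVKf // mulrC.
have [alpha] := lin_indep_minor bi; set M := \matrix_(i, j) _ => Mu.
pose Bv a : 'rV[C]_r := \row_j b j a.
pose Cs : 'M[C]_r := \matrix_(i, j) (c (alpha i) j 0)^*.
(* In the basis b of V_A the coefficient matrix of A becomes K. *)
pose K := invmx M *m Cs.
have cK beta : c beta = K *m (Bv beta)^t*.
  rewrite /K -mulmxA; apply: (canRL (mulKmx Mu)).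
  apply/colP => i; rewrite !mxE.
  transitivity (A (mcat (alpha i) beta)).
    by rewrite cE; apply: eq_bigr => j _; rewrite !mxE.
  rewrite Ah cE rmorph_sum; apply: eq_bigr => j _.
  by rewrite !mxE rmorphM mulrC.
have AK a beta : A (mcat a beta) = (Bv a *m K *m (Bv beta)^t*) 0 0.
  by rewrite -mulmxA -cK cE mxE; apply: eq_bigr => j _; rewrite mxE.
clearbody K.
have Kh : K^t* = K.
  have e : M *m K^t* *m M^t* = M *m K *m M^t*.
    have rowM i : row i M = Bv (alpha i) by apply/rowP => j; rewrite !mxE.
    have MKM L i j : (M *m L *m M^t*) i j =
        (Bv (alpha i) *m L *m (Bv (alpha j))^t*) 0 0.
      rewrite -!rowM -row_mul !mxE; apply: eq_bigr => l _.
      by rewrite !mxE.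
    apply/matrixP => i j; rewrite !MKM -AK Ah AK -[LHS]conjCK; congr (_^*).
    have -> (X : 'M[C]_1) : (X 0 0)^* = (X^t*) 0 0 by rewrite !mxE.
    by rewrite !adjM !trmxCK mulmxA.
  move: e; rewrite -!mulmxA => /(can_inj (mulKmx Mu)).
  have Mu' : M^t* \in unitmx by rewrite map_unitmx unitmx_tr.
  by move=> h; apply: (can_inj (mulmxK Mu')); apply: h.
have [Q [D [Qu Dr KQ]]] := hermitian_diag Kh.
pose phi j := \sum_i Q i j *: b i.
have phiE a : \row_j phi j a = Bv a *m Q.
  by apply/rowP => j; rewrite !mxE fcoef_sum; apply: eq_bigr => i _;
    rewrite fcoefZ mxE mulrC.
have phii : lin_indep phi.
  move=> x e; have : \sum_i (Q *m \col_j x j) i 0 *: b i = 0.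
    rewrite -[RHS]e; under [RHS]eq_bigr do rewrite scaler_sumr.
    rewrite exchange_big /=; apply: eq_bigr => i _.
    by rewrite mxE scaler_suml; apply: eq_bigr => j _; rewrite mxE scalerA mulrC.
  move/(bi (fun i => (Q *m \col_j x j) i 0)) => Qx j.
  have : Q *m \col_j x j = 0 by apply/colP => i; rewrite Qx mxE.
  move/(congr1 (mulmx (invmx Q))); rewrite mulKmx // mulmx0.
  by move/(congr1 (fun y : 'cV_r => y j 0)); rewrite !mxE.
have AE : A = sum_squares D phi.
  apply: fps_mcatP => a beta; rewrite AK fcoef_sum_squares KQ.
  rewrite !mulmxA -phiE -[_ *m Q^t* *m _]mulmxA -adjM -phiE mxE.
  by apply: eq_bigr => j _; rewrite mul_mx_diag !mxE mulrA [phi j a * _]mulrC.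
(* If D 0 j = 0, then r - 1 of the phi would span V_A. *)
have D0 j : D 0 j != 0.
  apply/eqP => Dj.
  suff /(lin_indep_leq bi) :
      forall i, lspan (range (fun l : 'I_#|predC1 j| => phi (enum_val l))) (b i).
    by rewrite cardC1 card_ord leqNgt ltn_predL (leq_ltn_trans _ (ltn_ord j)).
  move=> i; have : lspan (range (bar_deriv A)) (b i).
    by rewrite -bA; apply: sub_lspan; exists i.
  apply: lspan_sub => _ [beta _ <-]; rewrite AE.
  have [x _ ->] := bar_deriv_sum_squares D phi beta.
  apply/lspan_range; pose F l := x * D 0 l * (phi l beta)^*.
  exists (\row_l F (enum_val l)).
  rewrite (bigD1 j) //= Dj mulr0 mul0r scale0r add0r.
  rewrite (big_enum_val (fun l => F l *: phi l)) /=.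
  by apply: eq_bigr => l _; rewrite mxE.
by rewrite AE; apply: sum_squares_normalize.
Qed.

End Signature.

(** * Pullbacks of hyperquadrics *)

Section Snoc.
Variables (T : Type) (m : nat).
Implicit Types (x : 'I_m -> T) (y : T).

Lemma widen_lift (j : 'I_m) : widen_ord (leqnSn m) j = lift ord_max j.
Proof. by apply: val_inj; rewrite /= /bump leqNgt ltn_ord. Qed.

Lemma ord_maxP (P : 'I_m.+1 -> Prop) :
  P ord_max -> (forall j : 'I_m, P (widen_ord (leqnSn m) j)) -> forall i, P i.
Proof.
move=> Pm Pw i; case: (unliftP ord_max i) => [j|] -> //.
by rewrite -widen_lift.
Qed.

Definition snoc x y (i : 'I_m.+1) : T :=
  if unlift ord_max i is Some j then x j else y.
Lemma snoc_widen x y j : snoc x y (widen_ord (leqnSn m) j) = x j.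
Proof. by rewrite /snoc widen_lift liftK. Qed.
Lemma snoc_max x y : snoc x y ord_max = y.
Proof. by rewrite /snoc unlift_none. Qed.
End Snoc.

Section Quadric.
Variable C : numClosedFieldType.
Local Notation wid := (widen_ord (leqnSn _)).

Lemma wid_max n (j : 'I_n) : (wid j == ord_max) = false.
Proof. by rewrite widen_lift eq_sym (negbTE (neq_lift _ _)). Qed.
Lemma wid_inj n : injective (fun j : 'I_n => wid j).
Proof. by move=> i j; rewrite !widen_lift; apply: lift_inj. Qed.

Lemma holo_var d i : holo (fps_var C i) = zvar C i :> fps C (d + d).
Proof. by rewrite /holo subst_var //; apply: nocst_zvar. Qed.
Lemma aholo_var d i : aholo (fps_var C i) = zbar C i :> fps C (d + d).
Proof. by rewrite /aholo holo_var sconj_zvar. Qed.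

Definition Im_s d (g : fps C d) : fps C (d + d) :=
  (2 * 'i)^-1 *: (holo g - aholo g).

Definition qeq n (E : 'rV[C]_n) : fps C (n.+1 + n.+1) :=
  Im_s (fps_var C ord_max) - sum_squares E (fun j => fps_var C (wid j)).

Section Pull.
Variables (d e : nat) (H : 'I_e -> fps C d).
Hypothesis H0 : nocst H.
Lemma pull_Im_s g : pull (Im_s g) H = Im_s (fps_subst g H).
Proof. by rewrite pullZ pullB pull_holo // pull_aholo. Qed.

Lemma pull_sum_squares k (D : 'rV[C]_k) phi :
  pull (sum_squares D phi) H = sum_squares D (fun j => fps_subst (phi j) H).
Proof.
rewrite pull_sum; apply: eq_bigr => j _.
by rewrite pullZ pullM // pull_holo // pull_aholo.
Qed.
End Pull.

Lemma eq_sum_squares d k (D : 'rV[C]_k) (phi psi : 'I_k -> fps C d) :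
  phi =1 psi -> sum_squares D phi = sum_squares D psi.
Proof. by move=> e; apply: eq_bigr => j _; rewrite e. Qed.

Lemma pull_qeq d n (E : 'rV[C]_n) (H : 'I_n.+1 -> fps C d) : nocst H ->
  pull (qeq E) H = Im_s (H ord_max) - sum_squares E (fun j => H (wid j)).
Proof.
move=> H0; rewrite pullB pull_Im_s // pull_sum_squares // subst_var //.
by congr (_ - _); apply: eq_sum_squares => j; rewrite subst_var.
Qed.

Lemma pull_id d (f : fps C (d + d)) : pull f (fun i => fps_var C i) = f.
Proof.
rewrite -[RHS]subst_id; apply: eq_subst => i.
by case: (split_ordP i) => j ->; rewrite ?vcatl ?vcatr ?holo_var ?aholo_var.
Qed.

Lemma Im_sZ d a (g : fps C d) : a \is Num.real -> Im_s (a *: g) = a *: Im_s g.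
Proof.
move=> ar; rewrite /Im_s holoZ aholoZ (CrealP ar) -scalerBr !scalerA.
by rewrite mulrC.
Qed.

Lemma sum_squaresZ d k a (D : 'rV[C]_k) (phi : 'I_k -> fps C d) :
  sum_squares (a *: D) phi = a *: sum_squares D phi.
Proof.
rewrite /sum_squares scaler_sumr; apply: eq_bigr => j _.
by rewrite mxE scalerA.
Qed.

Lemma sum_squares_vanish d k r (D : 'rV[C]_k) (phi : 'I_k -> fps C d) :
  (forall j, vanish_order r (phi j)) -> vanish_order (r + r) (sum_squares D phi).
Proof.
move=> v; apply: vanish_order_sum => j _; apply: vanish_orderZ.
by apply: vanish_orderM; [apply: vanish_holo|apply: vanish_aholo].
Qed.

Lemma sum_squares_real d k (D : 'rV[C]_k) (phi : 'I_k -> fps C d) :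
  (forall j, D 0 j \is Num.real) -> sconj (sum_squares D phi) = sum_squares D phi.
Proof.
move=> Dr; rewrite sconj_sum; apply: eq_bigr => j _.
by rewrite sconjZ (CrealP (Dr j)) sconjM sconj_holo sconj_aholo mulrC.
Qed.

Lemma sum_squares_row_mx d k l (D : 'rV[C]_k) (D' : 'rV[C]_l)
    (phi : 'I_k -> fps C d) psi :
  sum_squares (row_mx D D') (vcat phi psi) = sum_squares D phi + sum_squares D' psi.
Proof.
rewrite /sum_squares big_split_ord; congr (_ + _); apply: eq_bigr => i _.
  by rewrite row_mxEl vcatl.
by rewrite row_mxEr vcatr.
Qed.

(** A decomposition of the matrix of a form decomposes its value at any vector of
    series. *)
Lemma sum_squares_change d N n k (E' : 'rV[C]_N) (E : 'rV[C]_n) (D : 'rV[C]_k)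
    (X : 'M[C]_(N, n)) (Y : 'M[C]_(N, k)) (F : 'I_N -> fps C d) :
  diag_mx E' = X *m diag_mx E *m X^t* + Y *m diag_mx D *m Y^t* ->
  sum_squares E' F = sum_squares E (fun i => \sum_l X l i *: F l) +
                     sum_squares D (fun i => \sum_l Y l i *: F l).
Proof.
move=> eD; apply: fps_mcatP => a b; rewrite fcoefD !fcoef_sum_squares.
pose R m (G : 'I_m -> fps C d) c : 'rV[C]_m := \row_j G j c.
have RE m (B : 'rV[C]_m) (G : 'I_m -> fps C d) :
    \sum_j B 0 j * (G j a * (G j b)^*) = (R m G a *m diag_mx B *m (R m G b)^t*) 0 0.
  by rewrite sesqui_diagE; apply: eq_bigr => j _; rewrite !mxE.
have RX m (Z : 'M[C]_(N, m)) c :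
    R m (fun i => \sum_l Z l i *: F l) c = R N F c *m Z.
  by apply/rowP => j; rewrite !mxE fcoef_sum; apply: eq_bigr => l _;
    rewrite !mxE fcoefZ mulrC.
by rewrite !RE !RX eD mulmxDr mulmxDl [LHS]mxE !adjM !mulmxA.
Qed.

End Quadric.

(** * Normal form of a transversal map *)

Section LowOrderTerms.
Variable C : numClosedFieldType.
Local Notation wid := (widen_ord (leqnSn _)).

(** The map (F, G) |-> (F - b G, G) / (1 + 2i <F, b> - i <b, b> G) is an
    automorphism of the hyperquadric fixing 0: in
    Im (G conj Q) - <F - b G, F - b G>, where Q is the denominator, the terms in
    b cancel. *)
Lemma parabolic d m (D : 'rV[C]_m) (F : 'I_m -> fps C d) (G u : fps C d)
    (b : 'I_m -> C) :
  (forall j, D 0 j \is Num.real) ->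
  (1 + (2 * 'i) *: (\sum_j (D 0 j * (b j)^*) *: F j) -
     ('i * \sum_j D 0 j * (b j * (b j)^*)) *: G) * u = 1 ->
  Im_s (G * u) - sum_squares D (fun j => (F j - b j *: G) * u) =
  holo u * aholo u * (Im_s G - sum_squares D F).
Proof.
move=> Dr Du.
pose S := \sum_j (D 0 j * (b j)^*) *: holo (F j).
pose S' := \sum_j (D 0 j * b j) *: aholo (F j).
pose be := \sum_j D 0 j * (b j * (b j)^*).
have ber : be^* = be.
  rewrite rmorph_sum; apply: eq_bigr => j _.
  by rewrite !rmorphM /= conjCK (CrealP (Dr j)) [(b j)^* * _]mulrC.
have Sh : holo (\sum_j (D 0 j * (b j)^*) *: F j) = S.
  by rewrite holo_sum; apply: eq_bigr => j _; rewrite holoZ.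
have Sa : aholo (\sum_j (D 0 j * (b j)^*) *: F j) = S'.
  rewrite aholo_sum; apply: eq_bigr => j _.
  by rewrite aholoZ rmorphM /= conjCK (CrealP (Dr j)).
have Uh : (1 + (2 * 'i) *: S - ('i * be) *: holo G) * holo u = 1.
  by rewrite -Sh -!holoZ -holo1 -holoD -holoB -holoM Du.
have Ua : (1 - (2 * 'i) *: S' + ('i * be) *: aholo G) * aholo u = 1.
  have := congr1 (@aholo C d) Du; rewrite aholoM aholoB aholoD !aholoZ Sa aholo1.
  rewrite !rmorphM /= conjCi ber rmorph_nat mulrN mulNr !scaleNr.
  by rewrite opprK.
have [c [sE cM c2]] : exists c : C -> fps C (d + d),
    [/\ forall k x, k *: x = c k * x, forall k l, c (k * l) = c k * c l & c 2 = 2].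
  exists (fun k => k%:A); split=> [k x|k l|]; first by rewrite mulr_algl.
    by rewrite -scalerAl mul1r scalerA.
  by rewrite scaler_nat.
have -> : sum_squares D (fun j => (F j - b j *: G) * u) =
    holo u * aholo u * (sum_squares D F - S * aholo G - S' * holo G
      + be *: (holo G * aholo G)).
  rewrite /sum_squares /S /S' /be scaler_suml !mulr_suml -!sumrB -big_split /=.
  rewrite mulr_sumr; apply: eq_bigr => j _.
  rewrite holoM aholoM holoB aholoB holoZ aholoZ !mulrBl !mulrBr.
  by rewrite !sE !cM; ring.
have I2 : (2 * 'i : C) != 0 by rewrite mulf_neq0 ?neq0Ci // pnatr_eq0.
apply: (scalerI I2).
rewrite /Im_s holoM aholoM [LHS]scalerBr scalerA mulfV // scale1r.
rewrite [in RHS]mulrBr [RHS]scalerBr -[X in _ = _ *: X - _]scalerAr.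
rewrite [X in _ = X - _]scalerA mulfV // scale1r.
rewrite -[holo G * holo u]mulr1 -[X in _ * X - _]Ua.
rewrite -[aholo G * aholo u]mulr1 -[X in _ - _ * X - _]Uh.
rewrite !sE !cM c2.
move: S S' be (sum_squares _ _) Sh Sa ber Uh Ua => S S' be T _ _ _ _ _.
ring.
Qed.

Lemma fcoefUl_Im_s d (g : fps C d) j :
  Im_s g U_(lshift d j)%MM = (2 * 'i)^-1 * g U_(j)%MM.
Proof.
rewrite /Im_s fcoefZ fcoefB -mcatUl fcoef_holo fcoef_aholo eqxx mnm1_eq0.
by rewrite mulr1 mulr0 subr0.
Qed.
Lemma fcoefUr_Im_s d (g : fps C d) j :
  Im_s g U_(rshift d j)%MM = - ((2 * 'i)^-1 * (g U_(j)%MM)^*).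
Proof.
rewrite /Im_s fcoefZ fcoefB -mcatUr fcoef_holo fcoef_aholo eqxx mnm1_eq0.
by rewrite mulr1 mulr0 sub0r mulrN.
Qed.

Lemma vanish_coefU d k (f : fps C d) i : vanish_order k f -> (1 < k)%N -> f U_(i)%MM = 0.
Proof. by move=> v k1; apply: v; rewrite mdeg1. Qed.

Section Levi.
Variables (n : nat) (E : 'rV[C]_n) (B : fps C (n.+1 + n.+1)).
Hypothesis B3 : vanish_order 3 B.

Lemma vanish_vars : vanish_order 2 (sum_squares E (fun j => fps_var C (wid j))).
Proof.
apply: (@sum_squares_vanish _ _ _ 1) => j.
by apply/vanish_order1P; rewrite fcoef0_var.
Qed.

Lemma fcoef0_qeq : (qeq E - B) 0%MM = 0.
Proof.
rewrite /qeq !fcoefB (vanish_vars (m := 0%MM)) ?mdeg0 // B3 ?mdeg0 // !subr0.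
by rewrite /Im_s fcoefZ fcoefB fcoef0_holo fcoef0_aholo fcoef0_var rmorph0 subrr mulr0.
Qed.
Lemma fcoefUl_qeq j :
  (qeq E - B) U_(lshift n.+1 j)%MM = (2 * 'i)^-1 * (j == ord_max)%:R.
Proof.
rewrite /qeq !fcoefB fcoefUl_Im_s fcoef_var eq_mnm1 (vanish_coefU _ vanish_vars) //.
by rewrite (vanish_coefU _ B3) // !subr0.
Qed.
Lemma fcoefUr_qeq j :
  (qeq E - B) U_(rshift n.+1 j)%MM = - ((2 * 'i)^-1 * (j == ord_max)%:R).
Proof.
rewrite /qeq !fcoefB fcoefUr_Im_s fcoef_var eq_mnm1 (vanish_coefU _ vanish_vars) //.
by rewrite (vanish_coefU _ B3) // !subr0 rmorph_nat.
Qed.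

Variables (N : nat) (E' : 'rV[C]_N) (F : 'I_N -> fps C n.+1) (G : fps C n.+1).
Variable q : fps C (n.+1 + n.+1).
Hypotheses (F0 : nocst F)
  (eqFG : Im_s G - sum_squares E' F = q * (qeq E - B)).

Let F2 : vanish_order 2 (sum_squares E' F).
Proof.
by apply: (@sum_squares_vanish _ _ _ 1) => j; apply/vanish_order1P; apply: F0.
Qed.

Let i2 : (2 * 'i : C)^-1 != 0.
Proof. by rewrite invr_eq0 mulf_neq0 ?neq0Ci // pnatr_eq0. Qed.

(** No term in z can appear, because the right-hand side has q(0) Im w as its only
    linear term; the term in wbar shows below that q(0) is real. *)
Lemma normal_derivative j : G U_(j)%MM = q 0%MM * (j == ord_max)%:R.
Proof.
have := congr1 (fun x => fcoef x U_(lshift n.+1 j)%MM) eqFG; cbv beta.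
rewrite fcoefB fcoefUl_Im_s (vanish_coefU _ F2) // subr0 fcoefUM fcoef0_qeq mulr0.
by rewrite addr0 fcoefUl_qeq mulrCA => /(mulfI i2).
Qed.

Lemma normal_derivative_real : q 0%MM \is Num.real.
Proof.
have := congr1 (fun x => fcoef x U_(rshift n.+1 ord_max)%MM) eqFG; cbv beta.
rewrite fcoefB fcoefUr_Im_s (vanish_coefU _ F2) // subr0 fcoefUM fcoef0_qeq mulr0.
rewrite addr0 fcoefUr_qeq mulrN mulrCA => /oppr_inj/(mulfI i2).
by rewrite normal_derivative eqxx mulr1 => /CrealP.
Qed.

Lemma fcoef_Im_s_mixed d (g : fps C d) i j :
  Im_s g (mcat U_(i)%MM U_(j)%MM) = 0.
Proof.
by rewrite /Im_s fcoefZ fcoefB fcoef_holo fcoef_aholo !mnm1_eq0 !mulr0 subrr mulr0.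
Qed.

Lemma fcoef_Mvar d (f : fps C d) i (m : 'X_{1..d}) : m i = 0%N -> (f * fps_var C i) m = 0.
Proof.
by move=> mi; rewrite mulrC -fps_monU fcoef_monM0 // lep1mP mi.
Qed.

(** The coefficients of z_i zbar_j are compared. Only q(0) matters on the right:
    the other terms of q contribute through Im w multiples of w or wbar, and
    otherwise terms of order at least 3. *)
Lemma levi_identity i j :
  \sum_l E' 0 l * (F l U_(wid i)%MM * (F l U_(wid j)%MM)^*) =
  q 0%MM * (E 0 i * (i == j)%:R).
Proof.
set m : 'X_{1..n.+1 + n.+1} := mcat U_(wid i)%MM U_(wid j)%MM.
have md : mdeg m = 2%N by rewrite mdeg_mcat !mdeg1.
have mmax k : k = lshift n.+1 ord_max \/ k = rshift n.+1 ord_max -> m k = 0%N.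
  by case=> ->; rewrite ?mcatl ?mcatr mnm1E wid_max.
pose Q := sum_squares E (fun j => fps_var C (wid j)) : fps C (n.+1 + n.+1).
have QE : Q m = E 0 i * (i == j)%:R.
  rewrite fcoef_sum_squares (bigD1 i) //= big1 ?addr0 => [|l li].
    rewrite ?fcoef_var eqxx mul1r eq_mnm1 (inj_eq (@wid_inj _)) rmorph_nat.
    by rewrite eq_sym.
  by rewrite ?fcoef_var eq_mnm1 (inj_eq (@wid_inj _)) eq_sym (negbTE li) mul0r mulr0.
pose q1 := q - q 0%MM *: 1.
have q10 : vanish_order 1 q1.
  by apply/vanish_order1P; rewrite fcoefB fcoefZ fcoef1 eqxx mulr1 subrr.
have := congr1 (fun x => fcoef x m) eqFG; cbv beta.
rewrite fcoefB fcoef_Im_s_mixed fcoef_sum_squares sub0r.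
have -> : q * (qeq E - B) = q 0%MM *: (qeq E - B) +
    (q1 * Im_s (fps_var C ord_max) - q1 * (Q + B)).
  rewrite -mulrBr opprD addrA -/(qeq E) mulrBl -scalerAl mul1r.
  by rewrite [RHS]addrC subrK.
have QB : vanish_order 2 (Q + B).
  by apply: vanish_orderD; [apply: vanish_vars|apply: vanish_orderW B3].
rewrite fcoefD fcoefZ !fcoefB fcoef_Im_s_mixed B3 ?md // subr0 sub0r QE.
rewrite (vanish_orderM q10 QB) ?md // subr0 /Im_s holo_var aholo_var.
rewrite -scalerAr fcoefZ mulrBr fcoefB !fcoef_Mvar ?mmax //; try by [left|right].
by rewrite subrr mulr0 addr0 mulrN => /oppr_inj.
Qed.
End Levi.
End LowOrderTerms.

Section Normalization.
Variable C : numClosedFieldType.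
Local Notation wid := (widen_ord (leqnSn _)).

Lemma fcoefU_Mu d (f u : fps C d) i : f 0%MM = 0 -> u 0%MM = 1 ->
  (f * u) U_(i)%MM = f U_(i)%MM.
Proof. by move=> f0 u1; rewrite fcoefUM f0 u1 mul0r add0r mulr1. Qed.

Lemma negs_posZ k (a : C) (D : 'rV[C]_k) : 0 < a ->
  negs (fun j => (a *: D) 0%R j) = negs (fun j => D 0%R j).
Proof. by move=> a0; apply: eq_bigr => j _; rewrite mxE pmulr_rlt0. Qed.

Lemma negs_negZ k (a : C) (D : 'rV[C]_k) : a < 0 ->
  negs (fun j => (a *: D) 0%R j) = negs (fun j => (- D) 0%R j).
Proof. by move=> a0; apply: eq_bigr => j _; rewrite !mxE nmulr_rlt0 // oppr_lt0. Qed.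

(** The new coordinates are the tangential part of F and G, normalized by an
    isotropy of the hyperquadric so that the differential is the identity; the
    remaining part of F, expressed in these coordinates, gives phi. *)
Lemma normal_form n (E : 'rV[C]_n) (B : fps C (n.+1 + n.+1))
    N (E' : 'rV[C]_N) (F : 'I_N -> fps C n.+1) (G : fps C n.+1)
    (q : fps C (n.+1 + n.+1)) :
  (forall j, E 0 j \is Num.real) -> (forall j, E 0 j * E 0 j = 1) ->
  (forall j, E' 0 j \is Num.real) ->
  vanish_order 3 B -> nocst F -> G 0%MM = 0 ->
  Im_s G - sum_squares E' F = q * (qeq E - B) ->
  (exists j, G U_(j)%MM != 0) ->
  exists k (D : 'rV[C]_k) (phi : 'I_k -> fps C n.+1) (Psi : 'I_n.+1 -> fps C n.+1)
    (q' : fps C (n.+1 + n.+1)),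
  [/\ (k <= N - n)%N, forall j, D 0 j \is Num.real,
      forall j, vanish_order 2 (phi j),
      nocst Psi /\ \matrix_(i, j) Psi i U_(j)%MM = 1%:M &
      [/\ q' 0%MM != 0,
       pull (qeq E - sum_squares D phi) Psi = q' * (qeq E - B) &
      (negs (fun j => E 0%R j) + negs (fun j => D 0%R j) <=
         negs (fun j => E' 0%R j))%N \/
      (negs (fun j => E 0%R j) + negs (fun j => D 0%R j) <=
         negs (fun j => (- E') 0%R j))%N /\
      (negs (fun j => (- E) 0%R j) <= negs (fun j => E' 0%R j))%N]].
Proof.
move=> Er E2 E'r B3 F0 G0 eqFG [j0 Gj0].
pose a := q 0%MM.
have ar : a \is Num.real := normal_derivative_real B3 F0 eqFG.
have GU j : G U_(j)%MM = a * (j == ord_max)%:R := normal_derivative B3 F0 eqFG j.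
have a0 : a != 0 by apply: contraNneq Gj0 => a0; rewrite GU a0 mul0r.
pose L : 'M[C]_(n, N) := \matrix_(i, l) F l U_(wid i)%MM.
have LL : L *m diag_mx E' *m L^t* = a *: diag_mx E.
  apply/matrixP => i j.
  rewrite mul_mx_diag !mxE -mulr_natr -(levi_identity B3 eqFG i j).
  by apply: eq_bigr => l _; rewrite !mxE mulrA [_ * E' 0 l]mulrC.
have [k [X [Y [d [kN LX LY dr [E'E neg1 neg2]]]]]] :=
  form_splitting E'r Er E2 ar a0 LL.
pose f i := \sum_l X l i *: F l; pose p i := \sum_l Y l i *: F l.
have FE : sum_squares E' F = a *: sum_squares E f + sum_squares d p.
  rewrite -sum_squaresZ; apply: sum_squares_change.
  have -> : diag_mx (a *: E) = a *: diag_mx E by exact: linearZ.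
  exact: E'E.
pose D := a^-1 *: d; pose g := a^-1 *: G.
have Vr : a^-1 \is Num.real by rewrite realV.
have Dr j : D 0 j \is Num.real by rewrite mxE realM.
pose W := row_mx E D; pose fp := vcat f p.
have Wr j : W 0 j \is Num.real.
  by case: (split_ordP j) => i ->; rewrite ?row_mxEl ?row_mxEr.
have eq1 : Im_s g - sum_squares W fp = (a^-1 *: q) * (qeq E - B).
  rewrite -scalerAl -eqFG FE Im_sZ // sum_squares_row_mx sum_squaresZ.
  by rewrite scalerBr scalerDr [_ *: (a *: _)]scalerA mulVf // scale1r.
have f0 : nocst f.
  by move=> i; rewrite fcoef_sum big1 // => l _; rewrite fcoefZ F0 mulr0.
have p0 : nocst p.
  by move=> i; rewrite fcoef_sum big1 // => l _; rewrite fcoefZ F0 mulr0.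
have fU i j : f i U_(wid j)%MM = (i == j)%:R.
  have := congr1 (fun M : 'M[C]_n => M j i) LX; rewrite !mxE eq_sym => <-.
  by rewrite fcoef_sum; apply: eq_bigr => l _; rewrite fcoefZ mxE mulrC.
have pU i j : p i U_(wid j)%MM = 0.
  have := congr1 (fun M : 'M[C]_(n, k) => M j i) LY; rewrite !mxE => <-.
  by rewrite fcoef_sum; apply: eq_bigr => l _; rewrite fcoefZ mxE mulrC.
have gU j : g U_(j)%MM = (j == ord_max)%:R.
  by rewrite fcoefZ GU mulrA mulVf // mul1r.
have g0 : g 0%MM = 0 by rewrite fcoefZ G0 mulr0.
clearbody g.
pose b i := fp i U_(ord_max)%MM.
have fp0 i : fp i 0%MM = 0 by case: (split_ordP i) => j ->; rewrite /fp ?vcatl ?vcatr.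
(* The denominator of the isotropy of the hyperquadric that removes the terms
   in w from fp. *)
pose Q := 1 + (2 * 'i) *: (\sum_j (W 0 j * (b j)^*) *: fp j) -
     ('i * \sum_j W 0 j * (b j * (b j)^*)) *: g.
have Q0 : Q 0%MM = 1.
  rewrite fcoefB fcoefD !fcoefZ g0 fcoef_sum big1 ?mulr0 ?subr0 ?addr0 => [|j _].
    by rewrite fcoef1 eqxx.
  by rewrite fcoefZ fp0 mulr0.
have [|u Qu] := @fps_unit _ _ Q; first by rewrite Q0 oner_neq0.
have u0 : u 0%MM = 1.
  by have := congr1 (fun x => fcoef x 0%MM) Qu; rewrite fcoef0M Q0 mul1r fcoef1 eqxx.
have eq2 := parabolic (b := b) Wr Qu.
pose fp' j := (fp j - b j *: g) * u; pose g' := g * u.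
have fp'0 j : fp' j 0%MM = 0 by rewrite fcoef0M fcoefB fcoefZ fp0 g0 mulr0 subrr mul0r.
have fp'U j i : fp' j U_(i)%MM = fp j U_(i)%MM - b j * (i == ord_max)%:R.
  by rewrite fcoefU_Mu ?fcoefB ?fcoefZ ?fp0 ?g0 ?mulr0 ?subrr // gU.
have g'0 : g' 0%MM = 0 by rewrite fcoef0M g0 mul0r.
have g'U i : g' U_(i)%MM = (i == ord_max)%:R by rewrite fcoefU_Mu ?gU.
pose Psi := snoc (fun i => fp' (lshift k i)) g'.
have Psi0 : nocst Psi.
  by apply: ord_maxP => [|j]; rewrite /Psi ?snoc_max ?snoc_widen.
have PsiJ : \matrix_(i, j) Psi i U_(j)%MM = 1%:M.
  apply/matrixP; apply: ord_maxP => [j|i].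
    by rewrite !mxE /Psi snoc_max g'U eq_sym.
  apply: ord_maxP => [|j]; rewrite !mxE /Psi snoc_widen fp'U.
    by rewrite eqxx mulr1 subrr wid_max.
  by rewrite wid_max mulr0 subr0 /fp vcatl fU (inj_eq (@wid_inj _)).
have Psiu : \matrix_(i, j) Psi i U_(j)%MM \in unitmx by rewrite PsiJ unitmx1.
have /choice[phi phiE] := fun j => subst_surj Psi0 Psiu (fp' (rshift n j)).
exists k, D, phi, Psi, (holo u * aholo u * (a^-1 *: q)); split=> //.
- move=> j; apply/vanish_order2P; split=> [|i].
    by rewrite -(fcoef0_subst (phi j) Psi0) phiE.
  have : fp' (rshift n j) U_(i)%MM = phi j U_(i)%MM.
    rewrite -phiE fcoefU_subst // (bigD1 i) //= big1 ?addr0 => [|l li].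
      have := congr1 (fun M : 'M[C]_n.+1 => M i i) PsiJ; rewrite !mxE eqxx => ->.
      by rewrite mulr1.
    have := congr1 (fun M : 'M[C]_n.+1 => M l i) PsiJ; rewrite !mxE (negbTE li) => ->.
    by rewrite mulr0.
  move<-; rewrite fp'U; move: i; apply: ord_maxP => [|i].
    by rewrite eqxx mulr1 subrr.
  by rewrite wid_max mulr0 subr0 /fp vcatr pU.
split.
- rewrite !fcoef0M fcoef0_holo fcoef0_aholo u0 rmorph1 !mul1r fcoefZ mulVf //.
  exact: oner_neq0.
- rewrite -mulrA -eq1 -eq2 pullB pull_qeq // pull_sum_squares //.
  rewrite -addrA -opprD /Psi snoc_max; congr (_ - _).
  rewrite -sum_squares_row_mx; apply: eq_sum_squares => j.
  by case: (split_ordP j) => i ->; rewrite ?vcatl ?vcatr ?snoc_widen ?phiE.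
- (* Dividing by a exchanges the signs when a is negative. *)
  have Dneg : (a < 0 -> negs (fun j => D 0%R j) = negs (fun j => (- d) 0%R j)) /\
      (0 < a -> negs (fun j => D 0%R j) = negs (fun j => d 0%R j)).
    by split=> as0; [rewrite negs_negZ ?invr_lt0|rewrite negs_posZ ?invr_gt0].
  have [as0|as0|e] := real_ltgtP (real0 C) ar; last by rewrite -e eqxx in a0.
    left; move: neg1; rewrite (Dneg.2 as0) => /(leq_trans _); apply.
    by rewrite negs_posZ.
  right; rewrite (Dneg.1 as0); split.
    apply: leq_trans neg2; rewrite leq_add2r -scaleNr negs_posZ // oppr_gt0 //.
  by rewrite -(negs_negZ _ as0); apply: leq_trans neg1; rewrite leq_addr.
Qed.
End Normalization.

Section NormalEquation.
Variable C : numClosedFieldType.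
Local Notation wid := (widen_ord (leqnSn _)).

(** Transport of [normal_form] from the coordinates Psi0, in which M is osculated
    by a hyperquadric, to arbitrary ones; the two equations differ by a unit,
    whose inverse gives the second divisibility. *)
Lemma normal_form_of_embedding n (E : 'rV[C]_n) (B : fps C (n.+1 + n.+1))
    N (E' : 'rV[C]_N) (H : 'I_N.+1 -> fps C n.+1) (Psi0 : 'I_n.+1 -> fps C n.+1)
    (rho r r1 r2 : fps C (n.+1 + n.+1)) :
  (forall j, E 0 j \is Num.real) -> (forall j, E 0 j * E 0 j = 1) ->
  (forall j, E' 0 j \is Num.real) -> vanish_order 3 B ->
  nocst Psi0 -> \matrix_(i, j) Psi0 i U_(j)%MM \in unitmx ->
  pull (qeq E - B) Psi0 = r1 * rho -> rho = r2 * pull (qeq E - B) Psi0 ->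
  nocst H -> (exists j, H ord_max U_(j)%MM != 0) ->
  pull (qeq E') H = r * rho ->
  exists k (D : 'rV[C]_k) (phi : 'I_k -> fps C n.+1) (Psi : 'I_n.+1 -> fps C n.+1),
  [/\ (k <= N - n)%N, forall j, D 0 j \is Num.real,
      forall j, vanish_order 2 (phi j),
      [/\ nocst Psi, \matrix_(i, j) Psi i U_(j)%MM \in unitmx,
        exists q, pull (qeq E - sum_squares D phi) Psi = q * rho &
        exists q, rho = q * pull (qeq E - sum_squares D phi) Psi] &
      (negs (fun j => E 0%R j) + negs (fun j => D 0%R j) <=
         negs (fun j => E' 0%R j))%N \/
      (negs (fun j => E 0%R j) + negs (fun j => D 0%R j) <=
         negs (fun j => (- E') 0%R j))%N /\
      (negs (fun j => (- E) 0%R j) <= negs (fun j => E' 0%R j))%N].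
Proof.
move=> Er E2 E'r B3 Psi00 Psiu eq1 eq2 H0 [j0 Hj0] Heq.
have [h [h0 hPsi Psih]] := formal_inverse Psi00 Psiu.
pose G := fps_subst (H ord_max) h; pose F j := fps_subst (H (wid j)) h.
have F0 : nocst F by move=> j; rewrite fcoef0_subst.
have G0 : G 0%MM = 0 by rewrite fcoef0_subst.
set f := qeq E - B in eq1 eq2.
have fE : pull (pull f Psi0) h = f.
  rewrite pull_comp // -[RHS]pull_id; congr pull.
  by apply/funext => i; rewrite Psih.
have HPsi i : H i = fps_subst (fps_subst (H i) h) Psi0.
  rewrite subst_assoc // -[LHS]subst_id; apply: eq_subst => j.
  by rewrite hPsi.
have Heq' : Im_s G - sum_squares E' F = pull (r * r2) h * f.
  transitivity (pull (pull (qeq E') H) h).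
    by rewrite pull_qeq // pullB pull_Im_s // pull_sum_squares.
  by rewrite Heq eq2 mulrA [LHS]pullM // fE.
have Gj : exists j, G U_(j)%MM != 0.
  apply: contrapT => /forallNP Gz; case/negP: Hj0; apply/eqP.
  rewrite HPsi fcoefU_subst // big1 // => i _.
  by have /negP := Gz i; rewrite negbK => /eqP ->; rewrite mul0r.
have [k [D [phi [Psi [q' [kN Dr phi2 [Psi0' PsiJ'] [q'0 eqPsi signs]]]]]]] :=
  normal_form Er E2 E'r B3 F0 G0 Heq' Gj.
pose Psi1 i := fps_subst (Psi i) Psi0.
have pE : pull (qeq E - sum_squares D phi) Psi1 = pull q' Psi0 * pull f Psi0.
  by rewrite -pull_comp // eqPsi pullM.
have [|u u1] := @fps_unit _ _ (pull q' Psi0); first by rewrite fcoef0_pull.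
exists k, D, phi, Psi1; split=> //; split.
- by move=> i; rewrite fcoef0_subst.
- have -> : \matrix_(i, j) Psi1 i U_(j)%MM = \matrix_(i, j) Psi0 i U_(j)%MM.
    rewrite -[RHS]mul1mx -PsiJ'; apply/matrixP => i j.
    rewrite !mxE fcoefU_subst //.
    by apply: eq_bigr => m _; rewrite !mxE.
  by [].
- by exists (pull q' Psi0 * r1); rewrite pE eq1 mulrA.
- exists (r2 * u); rewrite pE eq2 -[RHS]mulrA [u * _]mulrA [u * _]mulrC u1 mul1r.
  by rewrite -eq2.
Qed.
End NormalEquation.

(** * The map defined by a sum of squares *)

Section Embedding.
Variable C : numClosedFieldType.
Local Notation wid := (widen_ord (leqnSn _)).

Lemma sum_ltn r s : (s <= r)%N -> (\sum_(j < r) (j < s)%N)%N = s.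
Proof.
move=> sr; rewrite -[RHS]card_ord -sum1_card (big_ord_widen r (fun=> 1%N) sr).
rewrite [RHS]big_mkcond; apply: eq_bigr => j _; by case: (_ < _)%N.
Qed.

(** The map (z, chi, w), with the signs of all squares and of w exchanged when
    [flip] holds. *)
Lemma quadric_embedding d n l r s m (Psi : 'I_n.+1 -> fps C d)
    (chi : 'I_r -> fps C d) (flip : bool) :
  (l <= n)%N -> (s <= r)%N -> (r <= m)%N -> nocst Psi -> nocst chi ->
  exists H : 'I_(n + m).+1 -> fps C d,
  [/\ nocst H, H ord_max = (-1) ^+ flip *: Psi ord_max,
    forall i, exists j, H (wid j) = Psi (wid i) &
    pull (qeq (sgn_row C (n + m) (if flip then n + m - (l + s) else l + s)%N)) H =
      (-1) ^+ flip *: (Im_s (Psi ord_max) -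
        sum_squares (sgn_row C n l) (fun j => Psi (wid j)) -
        sum_squares (sgn_row C r s) chi)].
Proof.
move=> ln sr rm Psi0 chi0.
(* The components of z, the chi j, and zeros to reach the dimension n + m,
   with the sign of each square. *)
pose T := ('I_n + ('I_r + 'I_(m - r)))%type.
have cT : #|{: T}| = (n + m)%N by rewrite !card_sum !card_ord subnKC.
pose comp (t : T) := match t with
  inl i => Psi (wid i) | inr (inl j) => chi j | inr (inr _) => 0 end.
pose neg (t : T) : bool := match t with
  inl i => (i < l)%N | inr (inl j) => (j < s)%N | inr (inr _) => false end.
have negE : #|[pred t | neg t]| = (l + s)%N.
  transitivity (\sum_(t : T) neg t)%N.
    rewrite -sum1_card [LHS]big_mkcond /=; apply: eq_bigr => t _.
    by rewrite inE; case: (neg t).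
  rewrite big_sumType; congr (_ + _)%N; first exact: (sum_ltn ln).
  rewrite big_sumType -[RHS]addn0; congr (_ + _)%N; first exact: (sum_ltn sr).
  by apply: big1.
pose p := (if flip then n + m - (l + s) else l + s)%N.
have pE : #|[pred t | flip (+) neg t]| = p.
  rewrite /p -negE; case: (flip) => //=.
  rewrite -cT -(cardC [pred t | neg t]) addKn; by apply: eq_card => t; rewrite !inE.
have [sig [tau st ts] sigE] := @sort_pred {: T} _ (fun t => flip (+) neg t) cT.
pose H := snoc (fun j => comp (sig j)) ((-1) ^+ flip *: Psi ord_max).
have H0 : nocst H.
  apply: ord_maxP => [|j]; rewrite /H ?snoc_max ?snoc_widen.
    by rewrite fcoefZ Psi0 mulr0.
  by case: (sig j) => [i|[i|i]] /=; rewrite ?Psi0 ?chi0.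
exists H; split=> //.
- by rewrite /H snoc_max.
- by move=> i; exists (tau (inl i)); rewrite /H snoc_widen ts.
rewrite pull_qeq // /H snoc_max Im_sZ ?rpredX ?rpredN ?rpred1 //.
rewrite 2!scalerBr -[RHS]addrA; congr (_ + _); rewrite -opprD; congr (- _).
transitivity (\sum_(t : T) (-1) ^+ (flip (+) neg t) *: (holo (comp t) * aholo (comp t))).
  rewrite [RHS](reindex sig) /=; last by exists tau => t _; [apply: st|apply: ts].
  by apply: eq_bigr => j _; rewrite snoc_widen mxE sigE pE.
rewrite !big_sumType /= [X in _ + (_ + X)]big1 ?addr0; last first.
  by move=> i _; rewrite holo0 mul0r scaler0.
congr (_ + _); rewrite scaler_sumr; apply: eq_bigr => j _.
  by rewrite mxE scalerA signr_addb.
by rewrite mxE scalerA signr_addb.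
Qed.

Lemma negs_sgnN r s : (s <= r)%N -> negs (fun j => (- sgn_row C r s) 0%R j) = (r - s)%N.
Proof.
move=> sr; rewrite -[in RHS](sum_ltn sr); apply/eqP.
rewrite -(eqn_add2r (\sum_(j < r) (j < s)%N)%N) subnK; last first.
  by rewrite sum_ltn.
rewrite /negs -big_split /= -[X in _ == X]card_ord -sum1_card; apply/eqP.
apply: eq_bigr => j _; rewrite !mxE; case: (_ < _)%N => /=.
  by rewrite expr1 opprK ltr10.
by rewrite expr0 oppr_lt0 ltr01.
Qed.

Lemma negs_sgn r s : (s <= r)%N -> negs (fun j => sgn_row C r s 0%R j) = s.
Proof.
move=> sr; rewrite -[RHS](sum_ltn sr); apply: eq_bigr => j _.
by rewrite mxE signr_lt0.
Qed.

Lemma sgn_real r s j : sgn_row C r s 0 j \is Num.real.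
Proof. by rewrite mxE rpredX // rpredN rpred1. Qed.
Lemma sgn_sq r s j : sgn_row C r s 0 j * sgn_row C r s 0 j = 1.
Proof. by rewrite mxE -signr_addb addbb. Qed.

End Embedding.

(** * Germs of hypersurfaces *)

Section PullbackDerivative.
Variables (C : numClosedFieldType) (n d : nat) (E : 'rV[C]_n).
Variables (A : fps C (n.+1 + n.+1)) (Psi : 'I_n.+1 -> fps C d).
Hypotheses (A3 : vanish_order 3 A) (Psi0 : nocst Psi).

Let rest : vanish_order 2
  (sum_squares E (fun j => Psi (widen_ord (leqnSn n) j)) + pull A Psi).
Proof.
apply: vanish_orderD.
  by apply: (@sum_squares_vanish _ _ _ 1) => j; apply/vanish_order1P; apply: Psi0.
by apply: vanish_subst; [apply: nocst_pull|apply: vanish_orderW A3].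
Qed.

Lemma pull_qeqB : pull (qeq E - A) Psi = Im_s (Psi ord_max) -
  (sum_squares E (fun j => Psi (widen_ord (leqnSn n) j)) + pull A Psi).
Proof. by rewrite pullB pull_qeq // opprD addrA. Qed.

Lemma fcoefUl_pull_qeq j : pull (qeq E - A) Psi U_(lshift d j)%MM =
  (2 * 'i)^-1 * Psi ord_max U_(j)%MM.
Proof. by rewrite pull_qeqB fcoefB fcoefUl_Im_s (vanish_coefU _ rest) // subr0. Qed.
Lemma fcoefUr_pull_qeq j : pull (qeq E - A) Psi U_(rshift d j)%MM =
  - ((2 * 'i)^-1 * (Psi ord_max U_(j)%MM)^*).
Proof. by rewrite pull_qeqB fcoefB fcoefUr_Im_s (vanish_coefU _ rest) // subr0. Qed.
Lemma fcoef0_pull_qeq : pull (qeq E - A) Psi 0%MM = 0.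
Proof. by rewrite fcoef0_pull // fcoef0_qeq. Qed.

(** The tangent space only involves the differential of the last coordinate of
    Psi: the rest of the equation vanishes to second order. *)
Lemma tangent_form q (v : 'cV[C]_d) :
  \sum_j ((q * pull (qeq E - A) Psi) U_(lshift d j)%MM * v j 0 +
          (q * pull (qeq E - A) Psi) U_(rshift d j)%MM * (v j 0)^*) =
  q 0%MM * (2 * 'i)^-1 *
    (((\matrix_(i, j) Psi i U_(j)%MM) *m v) ord_max 0 -
     (((\matrix_(i, j) Psi i U_(j)%MM) *m v) ord_max 0)^*).
Proof.
rewrite mxE rmorph_sum -sumrB mulr_sumr; apply: eq_bigr => j _.
rewrite !fcoefUM fcoef0_pull_qeq !mulr0 !addr0 fcoefUl_pull_qeq fcoefUr_pull_qeq.
by rewrite mxE rmorphM /= mulrBr mulrN mulNr !mulrA.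
Qed.
End PullbackDerivative.

Section Bridge.
Variable R : realType.
Local Notation C := (R[i] : numClosedFieldType).

Lemma pullbackE d e (f : fps R[i] (e + e)) (H : 'I_e -> fps R[i] d) :
  pullback f H = @pull C d e f H.
Proof. by []. Qed.
Lemma holE d (f : fps R[i] d) : hol f = @holo C d f.
Proof. by []. Qed.
Lemma aholE d (f : fps R[i] d) : ahol f = @aholo C d f.
Proof. by []. Qed.
Lemma dbar0E d (f : fps R[i] (d + d)) : dbar0 f = @bar_deriv C d f.
Proof.
apply/funext => b; rewrite /dbar0.
have -> : [multinom vcat (fun=> 0%N) b i | i < d + d] = mcat 0%MM b.
  by apply/mnmP => i; rewrite !mnmE; case: (split_ordP i) => j ->;
    rewrite ?vcatl ?vcatr ?mnm0E.
by [].
Qed.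
Lemma VAE d (f : fps R[i] (d + d)) : VA f = lspan (range (@bar_deriv C d f)).
Proof. by rewrite /VA dbar0E. Qed.
Lemma has_rankE d (f : fps R[i] (d + d)) r :
  has_rank f r = has_dim (lspan (range (@bar_deriv C d f))) r.
Proof. by rewrite /has_rank VAE. Qed.

Lemma hermE d r s (phi : 'I_r -> fps R[i] d) :
  herm s (fun j => hol (phi j)) (fun j => ahol (phi j)) =
  @sum_squares C d r (sgn_row C r s) phi.
Proof.
apply: eq_bigr => j _; rewrite mxE.
by case: (j < s)%N; rewrite /= ?expr1 ?expr0 ?scaleN1r ?mulN1r ?scale1r ?mul1r.
Qed.

Lemma quadricE n l : quadric_eq R n l = qeq (sgn_row C n l).
Proof.
rewrite /qeq /Im_s holo_var aholo_var.
rewrite -(hermE l (fun j : 'I_n => fps_var R[i] (widen_ord (leqnSn n) j))).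
rewrite /quadric_eq; congr (_ - _); apply: eq_bigr => j _.
by rewrite holE holo_var aholE aholo_var.
Qed.
End Bridge.

Section Tangent.
Variable R : realType.
Local Notation C := (R[i] : numClosedFieldType).
Local Notation wid := (widen_ord (leqnSn _)).

Lemma jacobianE d e (H : 'I_e -> fps R[i] d) :
  jacobian H = \matrix_(i, j) H i U_(j)%MM.
Proof. by apply/matrixP => i j; rewrite !mxE fps_diff0E. Qed.

Lemma tangent_normal n l d (A : fps R[i] (n.+1 + n.+1)) (Psi : 'I_n.+1 -> fps R[i] d)
    (q f : fps R[i] (d + d)) p (v : 'cV[R[i]]_d) :
  vanish_order 3 A -> nocst Psi ->
  f = q * pullback (quadric_eq R n l - A) Psi ->
  (jacobian Psi *m v) ord_max 0 \is Num.real -> tangent (FGerm p f) v.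
Proof.
move=> A3 Psi0 -> /CrealP vr; rewrite /tangent /=.
under eq_bigr do rewrite !fps_diff0E.
rewrite pullbackE quadricE.
have := @tangent_form C n d (sgn_row C n l) A Psi A3 Psi0 q v.
rewrite -jacobianE vr subrr mulr0 => e; exact: e.
Qed.

Lemma hyperquadric_tangent N l (u : 'cV[R[i]]_N.+1) :
  tangent (hyperquadric R N l) u <-> u ord_max 0 \is Num.real.
Proof.
pose v (i : 'I_N.+1) : fps R[i] N.+1 := fps_var R[i] i.
have v0 : nocst v by move=> i; rewrite fcoef0_var.
have Jv : jacobian v = 1%:M.
  by apply/matrixP => i j; rewrite jacobianE !mxE fcoef_var eq_mnm1 eq_sym.
have z3 : vanish_order 3 (0 : fps R[i] (N.+1 + N.+1)) by [].
have eqE : quadric_eq R N l = 1 * pullback (quadric_eq R N l - 0) v.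
  by rewrite mul1r subr0 pullbackE [RHS](@pull_id C).
split=> [|ur]; last first.
  have Jr : (jacobian v *m u) ord_max 0 \is Num.real by rewrite Jv mul1mx.
  exact: (@tangent_normal N l N.+1 0 v 1 (quadric_eq R N l) 0 u z3 v0 eqE Jr).
rewrite /tangent /=; under eq_bigr do rewrite !fps_diff0E.
have := @tangent_form C N _ (sgn_row C N l) 0 v z3 v0 1 u.
rewrite -[qeq _]quadricE -[pull _ _]pullbackE -eqE => -> /eqP.
rewrite fcoef1 eqxx mul1r mulf_eq0 invr_eq0 mulf_eq0 pnatr_eq0 /= (negbTE (neq0Ci _)).
rewrite [X in X *m u](_ : _ = 1%:M); last by rewrite -Jv jacobianE.
rewrite mul1mx /= subr_eq0 => /eqP e.
by apply/CrealP; rewrite -e.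
Qed.

(** A vector v is complex tangent when v and - i v are tangent, that is, when
    the real and imaginary parts of its last component both vanish. *)
Lemma hyperquadric_ctangent N l (u : 'cV[R[i]]_N.+1) :
  ctangent (hyperquadric R N l) u <-> u ord_max 0 = 0.
Proof.
split=> [[/hyperquadric_tangent ur [w /hyperquadric_tangent wr e]]|u0].
  move: ur; rewrite -e mxE => iw.
  apply/eqP; rewrite mulf_eq0 (negbTE (neq0Ci _)) /=.
  move/CrealP: iw; rewrite rmorphM /= conjCi (CrealP wr) mulNr => /eqP.
  by rewrite eq_sym -addr_eq0 -mulr2n mulrn_eq0 /= mulf_eq0 (negbTE (neq0Ci _)).
split; first by apply/hyperquadric_tangent; rewrite u0 real0.
exists (- 'i *: u); last by rewrite scalerA mulrN -expr2 sqrCi opprK scale1r.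
by apply/hyperquadric_tangent; rewrite mxE u0 mulr0 real0.
Qed.
End Tangent.

Section Realization.
Variable R : realType.
Local Notation C := (R[i] : numClosedFieldType).
Local Notation wid := (widen_ord (leqnSn _)).

Lemma has_dim_uniq (K : fieldType) (V : lmodType K) (W : set V) r s :
  has_dim W r -> has_dim W s -> r = s.
Proof.
move=> [b [bi bW]] [c [ci cW]]; apply/eqP; rewrite eqn_leq; apply/andP; split.
  by apply: (lin_indep_leq bi (phi := c)) => j; rewrite cW -bW; apply: sub_lspan; exists j.
by apply: (lin_indep_leq ci (phi := b)) => j; rewrite bW -cW; apply: sub_lspan; exists j.
Qed.

Lemma real_valued_coef d (A : fps R[i] (d + d)) : real_valued A ->
  forall a b, A (mcat b a) = (A (mcat a b))^*.
Proof.
move=> Ar a b; have e : @sconj C d A = A := Ar.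
by rewrite -{1}e fcoef_sconj.
Qed.

(** The default value of [xget] is not reached. *)
Lemma signature_exists d (A : fps R[i] (d + d)) r : real_valued A -> has_rank A r ->
  is_signature A (signature A).
Proof.
move=> Areal; rewrite has_rankE => Ar.
have [s [psi [sr psii AE]]] := @hermitian_sum_squares C d A r (real_valued_coef Areal) Ar.
apply: xgetPex; exists s, r, psi; split=> //; first by rewrite has_rankE.
by rewrite AE hermE.
Qed.

(** By [sum_squares_inertia], the bound holds for every s with [is_signature], in
    particular for the one selected by [signature]. *)
Lemma signature_le d k (D : 'rV[C]_k) (phi : 'I_k -> fps R[i] d) :
  (forall j, D 0 j \is Num.real) ->
  (signature (@sum_squares C d k D phi) <= negs (fun j => D 0%R j))%N.
Proof.
move=> Dr; rewrite /signature; case: xgetP => // s _ [r [psi [_ sr psii e]]].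
rewrite -(negs_sgn C sr); apply: (sum_squares_inertia psii Dr).
exact: (etrans (esym (hermE s psi)) (esym e)).
Qed.

(** Since phi is independent and V_A has dimension r, each phi_j lies in V_A,
    hence vanishes at 0 and the map is centered. The vector d/dw is tangent to M
    and its image is transversal. *)
Lemma embedding_of_normal_equation n l (M : fgerm R n.+1) k Psi A :
  (l <= n)%N -> normal_equation l M Psi A -> class_H k A ->
  let s := signature A in
  (s <= k)%N /\ forall flip : bool, transversally_embeds M
    (hyperquadric R (n + k)%N (if flip then n + k - (l + s) else l + s)%N).
Proof.
move=> ln [[Psi0 PsiJ] Areal A4 [[q eq1] [q' eq2]]] [_ [r rk Ar] Hlin] s.
have A3 : vanish_order 3 A by apply: vanish_orderW A4.
have [r' [phi [Ar' sr phii AE]]] := signature_exists Areal Ar.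
have rr' : r' = r by apply: has_dim_uniq Ar' Ar.
rewrite -/s {}rr' {r' Ar'} in phi sr phii AE *.
have phi0 : nocst phi.
  move=> j; apply: (Hlin (phi j)); last by rewrite mdeg0.
  move: Ar; rewrite /has_rank => -[b [bi bW]]; rewrite -bW.
  apply: (lin_indep_in_span bi) => i.
  have : VA A (b i) by rewrite -bW; apply: sub_lspan; exists i.
  rewrite VAE AE hermE => h; exact: (bar_deriv_span h).
split=> [|flip]; first exact: leq_trans sr rk.
have [H [H0 Hmax HPsi Heq]] := @quadric_embedding C n.+1 n l r s k Psi
  (fun j => fps_subst (phi j) Psi) flip ln sr rk Psi0 (nocst_subst Psi0 phi0).
have pE : pull (qeq (sgn_row C n l) - A) Psi =
    Im_s (Psi ord_max) - sum_squares (sgn_row C n l) (fun j => Psi (wid j)) -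
      sum_squares (sgn_row C r s) (fun j => fps_subst (phi j) Psi).
  by rewrite pullB pull_qeq // AE hermE pull_sum_squares.
have JE m (K : 'I_m -> fps R[i] n.+1) (v : 'cV_n.+1) i :
    (jacobian K *m v) i 0 = \sum_j K i U_(j)%MM * v j 0.
  by rewrite jacobianE mxE; apply: eq_bigr => j _; rewrite mxE.
have Jmax (v : 'cV_n.+1) : (jacobian H *m v) ord_max 0 = (-1) ^+ flip * (jacobian Psi *m v) ord_max 0.
  by rewrite !JE mulr_sumr; apply: eq_bigr => j _; rewrite Hmax fcoefZ mulrA.
exists H; split; first split=> //.
- move=> v w e; apply: (can_inj (mulKmx PsiJ)); apply/colP.
  apply: ord_maxP => [|i].
    apply: (@mulfI _ ((-1) ^+ flip)); first by rewrite signr_eq0.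
    by rewrite -!Jmax e.
  have [j Hj] := HPsi i.
  have := congr1 (fun x : 'cV_ _ => x (wid j) 0) e.
  by rewrite !JE Hj.
- exists ((-1) ^+ flip *: q); rewrite -scalerAl -eq1.
  rewrite !pullbackE [fh_eq _]quadricE quadricE pE; exact: Heq.
- (* The vector d/dw in the coordinates Psi. *)
  pose v : 'cV_n.+1 := invmx (jacobian Psi) *m delta_mx ord_max 0.
  have Jv : jacobian Psi *m v = delta_mx ord_max 0 by rewrite mulKVmx.
  move=> /(_ (jacobian H *m v)) sub.
  have : tangent M v.
    case: M {eq1 sub} eq2 => p f eq2.
    have vr : (jacobian Psi *m v) ord_max 0 \is Num.real.
      by rewrite Jv mxE !eqxx rpred1.
    exact: (@tangent_normal R n l n.+1 A Psi q' f p v A3 Psi0 eq2 vr).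
  move=> tv; have /hyperquadric_ctangent := sub (ex_intro2 _ _ v tv erefl).
  rewrite Jmax Jv mxE !eqxx mulr1 => /eqP.
  by rewrite signr_eq0.
Qed.
End Realization.

Section Converse.
Variable R : realType.
Local Notation C := (R[i] : numClosedFieldType).
Local Notation wid := (widen_ord (leqnSn _)).

(** Transversality enters through G: if all its first derivatives vanished, the
    image of the differential would lie in w = 0, the complex tangent space. *)
Lemma normal_equation_of_embedding n l (M : fgerm R n.+1) N l' :
  (l <= n)%N -> (l' <= N)%N -> Levi_nondegenerate l M ->
  transversally_embeds M (hyperquadric R N l') ->
  exists Psi k (D : 'rV[C]_k) (phi : 'I_k -> fps R[i] n.+1),
    [/\ normal_equation l M Psi (sum_squares D phi), (k <= N - n)%N,
        forall j, D 0 j \is Num.real, forall j, vanish_order 2 (phi j) &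
        (l + negs (fun j => D 0%R j) <= l')%N \/
        (l + negs (fun j => D 0%R j) <= N - l')%N /\ (n - l <= l')%N].
Proof.
move=> ln l'N [Psi0 [B [[Psi00 PsiJ] _ B3 [[q1 eq1] [q2 eq2]]]]].
move=> [H [[H0 _ [q Heq]] Htr]].
have B'3 : vanish_order 3 (subst_z_Rew B).
  apply: (@vanish_subst C) B3; apply: (@nocst_vcat C) => [|_].
    by apply: (@nocst_vcat C) => j; apply: fcoef0_var.
  by rewrite /Re_w fcoefZ fcoefD !fcoef0_var addr0 mulr0.
have Psiu : \matrix_(i, j) Psi0 i U_(j)%MM \in unitmx by rewrite -jacobianE.
have Hj : exists j, H ord_max U_(j)%MM != 0.
  apply: contrapT => /forallNP Hz; apply: Htr => _ [v _ <-].
  apply/hyperquadric_ctangent; rewrite jacobianE mxE big1 // => j _.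
  by rewrite mxE; have /negP := Hz j; rewrite negbK => /eqP ->; rewrite mul0r.
rewrite pullbackE quadricE in eq1; rewrite pullbackE quadricE in eq2.
rewrite pullbackE [fh_eq _]quadricE in Heq.
have [k [D [phi [Psi [kN Dr phi2 [Psi10 Psi1u eq3 eq4] signs]]]]] :=
  @normal_form_of_embedding C n (sgn_row C n l) (subst_z_Rew B) N (sgn_row C N l')
    H Psi0 (fh_eq M) q q1 q2 (@sgn_real C n l) (@sgn_sq C n l) (@sgn_real C N l')
    B'3 Psi00 Psiu eq1 eq2 H0 Hj Heq.
rewrite !negs_sgn // !negs_sgnN // in signs.
exists Psi, k, D, phi; split; [|exact: kN|exact: Dr|exact: phi2|exact: signs].
split.
- by split; [exact: Psi10|rewrite jacobianE; exact: Psi1u].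
- exact: (@sum_squares_real C _ _ D phi Dr).
- exact: (@sum_squares_vanish C _ _ 2 D phi phi2).
- by split; rewrite pullbackE quadricE; [exact: eq3|exact: eq4].
Qed.

Lemma sum_squares_rank_le d k N (D : 'rV[C]_k) (phi : 'I_k -> fps R[i] d) :
  (k <= N)%N -> rank_le (sum_squares D phi) N.
Proof.
move=> kN; have [r rk h] := sum_squares_rank D phi.
by exists r; [apply: leq_trans kN|rewrite has_rankE].
Qed.

Lemma sum_squares_class_H d k N (D : 'rV[C]_k) (phi : 'I_k -> fps R[i] d) :
  (k <= N)%N -> (forall j, D 0 j \is Num.real) ->
  (forall j, vanish_order 2 (phi j)) -> class_H N (sum_squares D phi).
Proof.
move=> kN Dr phi2; split; first exact: (@sum_squares_real C _ _ D phi Dr).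
  exact: sum_squares_rank_le.
move=> f; rewrite VAE => /(@bar_deriv_span C _ _ D phi)/lspan_range[c ->] m m1.
rewrite fcoef_sum big1 // => j _.
by rewrite fcoefZ phi2 ?mulr0.
Qed.
End Converse.

(* The converse half of (1) produces an embedding into a hyperquadric of some
   signature l'' >= l, the one computed in (2); it cannot hold for every l' >= l.
   For n = N = 2, l = 0, l' = 1 and A = 0, M is Im w = |z_1|^2 + |z_2|^2, which
   has no transversal embedding into Im w = -|z_1|^2 + |z_2|^2. *)
Theorem proposition1p2 (R : realType) (n l : nat) (M : fgerm R n.+1)
    (N l' : nat) :
  formal_hypersurface M ->
  (l.*2 <= n)%N ->
  Levi_nondegenerate l M ->
  (n <= N)%N ->
  (l'.*2 <= N)%N ->
  [/\ (* (1) *)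
      (transversally_embeds M (hyperquadric R N l') ->
         (l <= l')%N /\
         exists Psi A, normal_equation l M Psi A /\ class_H (N - n) A) /\
      ((exists Psi A, normal_equation l M Psi A /\ class_H (N - n) A) ->
         exists l'' : nat,
           [/\ (l <= l'')%N, (l''.*2 <= N)%N &
               transversally_embeds M (hyperquadric R N l'')]),
      (* (2) *)
      (forall k Psi A, normal_equation l M Psi A -> class_H k A ->
         transversally_embeds M
           (hyperquadric R (n + k)
              (minn (l + signature A) (n + k - l - signature A)))) &
      (* (3) *)
      (transversally_embeds M (hyperquadric R N l') ->
         exists Psi A,
           [/\ normal_equation l M Psi A,
               rank_le A (N - n),
               (signature A)%:Z <=
                 Num.max (l'%:Z - l%:Z) (N%:Z - l'%:Z - l%:Z) &
               (l' < n - l)%N -> (signature A)%:Z <= l'%:Z - l%:Z])].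
Proof.
move=> _ ln Levi nN l'N.
have l_n : (l <= n)%N by rewrite -addnn in ln; apply: leq_trans ln; apply: leq_addr.
have l'_N : (l' <= N)%N by rewrite -addnn in l'N; apply: leq_trans l'N; apply: leq_addr.
have part2 k Psi A : normal_equation l M Psi A -> class_H k A ->
    (signature A <= k)%N /\ transversally_embeds M
      (hyperquadric R (n + k)
         (minn (l + signature A) (n + k - l - signature A))).
  move=> eqA HA; have [sk emb] := embedding_of_normal_equation l_n eqA HA.
  split=> //; rewrite -subnDA.
  case: (leqP (l + signature A) (n + k - (l + signature A))) => _.
    exact: (emb false).
  exact: (emb true).
have conv := normal_equation_of_embedding l_n l'_N Levi.
split; first split.
- move=> /conv[Psi [k [D [phi [eqA kN Dr phi2 signs]]]]]; split.
    case: signs => [|[_ h]]; first by apply: leq_trans; apply: leq_addr.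
    by apply: leq_trans h; rewrite leq_subRL // addnn.
  by exists Psi, (sum_squares D phi); split=> //; apply: sum_squares_class_H.
- move=> [Psi [A [eqA HA]]]; have [sN] := part2 _ _ _ eqA HA.
  rewrite (subnKC nN) => emb; exists (minn (l + signature A) (N - l - signature A)).
  split; last exact: emb.
    rewrite leq_min leq_addr /= -subnDA leq_subRL; last first.
      by rewrite -(subnKC nN) leq_add.
    by rewrite addnAC addnn -(subnKC nN) leq_add.
  rewrite -subnDA -addnn; apply: (@leq_trans (l + signature A + (N - (l + signature A)))).
    by apply: leq_add; [apply: geq_minl|apply: geq_minr].
  by rewrite subnKC // -(subnKC nN) leq_add.
- by move=> k Psi A eqA HA; case: (part2 _ _ _ eqA HA).
- move=> /conv[Psi [k [D [phi [eqA kN Dr phi2 signs]]]]].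
  exists Psi, (sum_squares D phi); have := signature_le phi Dr.
  set s := signature _ => sD; split=> //; first exact: sum_squares_rank_le.
    rewrite le_max !lerBrDr -!PoszD !lez_nat; apply/orP.
    case: signs => [h|[h _]]; [left|right].
      by apply: leq_trans h; rewrite addnC leq_add2l.
    rewrite -(leq_add2r l') in h; rewrite (subnK l'_N) in h.
    by apply: leq_trans h; rewrite leq_add2r addnC leq_add2l.
  move=> l'lt; rewrite lerBrDr -PoszD lez_nat.
  case: signs => [h|[_ h]]; last by move: l'lt; rewrite ltnNge h.
  by apply: leq_trans h; rewrite addnC leq_add2l.
Qed.
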